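(* Let $\delta=\delta(n)>0$ be any function of the number of vertices $n$. Then the competitive ratio of $\textsc{Blocking}_\delta$ is (a) at least $\Omega(\log(n)/\log(\log(n)))$; (b) at least $\Omega(\log(n))$ if $\delta\in o(\log(n)/\log\log(n))$, and also if $\delta\in\Omega(\log(n))$.
   Context: Online graph exploration: an agent starts at a vertex $v$ of an initially unknown connected undirected graph $G=(V,E)$ with edge weights $w\colon E\to\mathbb{R}_{\ge 0}$. When the agent visits a vertex it learns the identifiers of all adjacent vertices and the weights of the incident edges. Traversing an edge costs its weight. The agent must visit all vertices and return to $v$. $\textsc{Alg}(G,v)$ is the total cost of the algorithm and $\textsc{Opt}(G)$ the length of a shortest closed walk visiting all vertices. The competitive ratio of an algorithm, as a function of $n$, is the supremum of $\textsc{Alg}(G,v)/\textsc{Opt}(G)$ over all graphs $G$ with $n$ vertices, start vertices $v$, and all ways the algorithm may make its free (tie-breaking) choices. Algorithm $\textsc{Blocking}_\delta$. A vertex is explored once visited. A boundary edge $e=(u,x)$ is an edge with $u$ explored and $x$ unexplored. For vertices $x,y$, $d(x,y)$ is the current length of a shortest path from $x$ to $y$ all of whose internal vertices are explored. A boundary edge $e=(u,x)$ is $\delta$-blocked if there is another boundary edge $e'=(u',x')$ with $w(e')<w(e)$ and $d(u,x')\le(1+\delta)w(e)$. The recursive procedure $\textsc{Blocking}_\delta(v)$ ($v$ the current position) is: while there is a boundary edge $e=(y,x)$ that is not $\delta$-blocked and such that either $y=v$ or $e$ was at some earlier time $\delta$-blocked by a boundary edge whose unexplored endpoint was $v$, do: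 traverse a shortest internally explored path from $v$ to $y$; traverse $e$; call $\textsc{Blocking}_\delta(x)$; traverse a shortest internally explored path from $x$ back to $v$. The algorithm is the call at the start vertex; ties among qualifying edges are broken arbitrarily. *)

(* Defs.v *)
From HB Require Import structures.
From mathcomp Require Import all_boot all_order all_algebra.
From mathcomp Require Import all_classical all_reals all_analysis.
Set Implicit Arguments.
Unset Strict Implicit.
Unset Printing Implicit Defensive.
Import Order.TTheory GRing.Theory Num.Theory.
Import numFieldNormedType.Exports.
Local Open Scope classical_set_scope.
Local Open Scope ring_scope.

(* The values of [wt] outside [adj] are irrelevant. *)
Record wgraph (R : realType) (V : finType) := WGraph {
  adj : rel V;
  wt : V -> V -> R;
  adj_sym : symmetric adj;
  adj_irrefl : irreflexive adj;
  adj_connected : forall x y : V, connect adj x y;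
  wt_sym : forall x y : V, adj x y -> wt x y = wt y x;
  wt_ge0 : forall x y : V, adj x y -> 0 <= wt x y }.

Section Blocking.
Context (R : realType) (V : finType) (G : wgraph R V).

Fixpoint walk_length (x : V) (p : seq V) : R :=
  if p is y :: p' then wt G x y + walk_length y p' else 0.

(* The length of a shortest closed walk visiting all vertices. *)
Definition Opt : R :=
  inf [set l | exists x p, [/\ path (adj G) x p, last x p = x,
    (forall z, z \in x :: p) & l = walk_length x p]].

(* The state of the exploration is the sequence [s] of explored vertices in the
   order in which they were first visited.  The boundary edges and the distances
   change only when a new vertex is explored, so the earlier moments are the
   proper prefixes of [s]. *)

(* [behead (belast x p)] lists the internal vertices of the walk [x :: p].  As
   weights are nonnegative, ranging over walks or over simple paths gives the
   same value.  In a run, every [dist s x y] that is used has [x] explored and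
   [y] explored or adjacent to an explored vertex, so that the set is nonempty
   (the explored vertices induce a connected subgraph). *)
Definition dist (s : seq V) (x y : V) : R :=
  inf [set l | exists p, [/\ path (adj G) x p, last x p = y,
    {subset behead (belast x p) <= s} & l = walk_length x p]].

Definition boundary (s : seq V) (u x : V) : bool :=
  [&& adj G u x, u \in s & x \notin s].

(* The boundary edge [(u', x')] makes the boundary edge [(u, x)] d-blocked. *)
Definition blocks (d : R) (s : seq V) (u' x' u x : V) : bool :=
  [&& boundary s u x, boundary s u' x', wt G u' x' < wt G u x
    & dist s u x' <= (1 + d) * wt G u x].

Definition blocked (d : R) (s : seq V) (u x : V) : bool :=
  [exists u', exists x', blocks d s u' x' u x].

Definition earlier_blocked_via (d : R) (s : seq V) (v y x : V) : bool :=
  [exists k : 'I_(size s), exists u', blocks d (take k s) u' v y x].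

Definition qualifies (d : R) (s : seq V) (v y x : V) : bool :=
  [&& boundary s y x, ~~ blocked d s y x
    & (y == v) || earlier_blocked_via d s v y x].

(* [run d s v s' c]: the recursive procedure called at position [v] in state [s]
   can terminate in state [s'], back at [v], with total traversal cost [c].
   The first constructor is the exit of the while loop; in the second one, the
   premise [run d s1 v s2 c2] is the continuation of the loop after the
   iteration that follows the edge [(y, x)]. *)
Inductive run (d : R) : seq V -> V -> seq V -> R -> Prop :=
| run_exit s v :
    (forall y x, ~~ qualifies d s v y x) -> run d s v s 0
| run_iter s v y x s1 c1 s2 c2 :
    qualifies d s v y x ->
    run d (rcons s x) x s1 c1 ->
    run d s1 v s2 c2 ->
    run d s v s2 (dist s v y + wt G y x + c1 + dist s1 x v + c2).

Definition Blocking_cost (d : R) (v : V) (c : R) : Prop :=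
  exists s, run d [:: v] v s c.

End Blocking.

(* Instances with [Opt G = 0], where the quotient is meaningless, are left out. *)
Definition competitive_ratio (R : realType) (d : R) (n : nat) : \bar R :=
  ereal_sup [set r | exists (V : finType) (G : wgraph R V) (v : V) (c : R),
    [/\ #|V| = n, Blocking_cost G d v c, 0 < Opt G & r = (c / Opt G)%:E]].

(* Omega for functions with values in the extended reals, in which a supremum
   may a priori be infinite. *)
Definition eOmega (R : realType) (f : nat -> \bar R) (g : nat -> R) : Prop :=
  exists2 c : R, 0 < c & \forall n \near \oo, ((c * g n)%:E <= f n)%E.

Definition log_nat (R : realType) (n : nat) : R := ln n%:R.

Definition log_over_loglog (R : realType) (n : nat) : R :=
  log_nat R n / ln (log_nat R n).

(* Main.v *)
(* Two families of instances are combined.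

   Large delta: a broom, that is a path of [m] edges of weight 1, with
   [m <= 2 (1 + delta)], and [k >= m] leaves attached to its first vertex by
   edges of weight 2. While the path is being explored, its last edge blocks all
   leaf edges, so the agent may serve each leaf from the far end of the path and
   return there. It pays at least [k m], whereas Opt is O(k); the ratio is
   Omega(min(delta, log n)).

   Small delta: the classical greedy construction of sparse hypergraphs of large
   girth gives [K] clusters, each a star with [D] leaves and very light edges,
   whose leaves are attached by edges of weight about 1 ("heavy" edges) to [D]
   vertices ("tails") of a path (the "spine") that are pairwise at distance
   exactly delta. If the agent explores a leaf of a cluster, then the light edge
   to the center of the cluster does not block the heavy edges to the remaining
   leaves, because their tails are still too far away from each other; so all
   [K D] heavy edges are traversed, while Opt only needs one of them per cluster
   and is O(K). This works as long as [log n ^ O(delta) <= n] with [D] about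
   [log n], i.e. for delta <= c log n / log log n. The heavy weights increase
   slightly in the order of exploration: then the heavy edge just traversed was
   blocking the next one, which is therefore available at the current vertex. *)

Require Import Defs.
From mathcomp Require Import all_boot all_order all_algebra.
From mathcomp Require Import all_classical all_reals all_analysis.
From mathcomp Require Import zify ring lra.
Import Order.TTheory GRing.Theory Num.Theory.
Import numFieldNormedType.Exports.
Local Open Scope classical_set_scope.
Local Open Scope ring_scope.

Set Implicit Arguments.
Unset Strict Implicit.
Unset Printing Implicit Defensive.

(** * Runs, distances and tours *)

Section Exploration.
Context (R : realType) (V : finType) (G : wgraph R V).
Implicit Types (s p : seq V) (x y z u v : V) (d : R).

Lemma walk_length_ge0 x p : path (adj G) x p -> 0 <= walk_length G x p.
Proof.
elim: p x => [|y p IH] x //= /andP[xy py].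
by rewrite addr_ge0 ?IH // wt_ge0.
Qed.

Lemma walk_length_cat x p q :
  walk_length G x (p ++ q) = walk_length G x p + walk_length G (last x p) q.
Proof. by elim: p x => [|y p IH] x /=; rewrite ?add0r // IH addrA. Qed.

Lemma dist_ge0 s x y : 0 <= dist G s x y.
Proof.
rewrite /dist; set A := [set l | _].
have [->|A0] := eqVneq A set0; first by rewrite inf0.
apply: lb_le_inf; first exact/set0P.
by move=> _ [p [px _ _ ->]]; exact: walk_length_ge0.
Qed.

Lemma dist_le s x y p : path (adj G) x p -> last x p = y ->
  {subset behead (belast x p) <= s} -> dist G s x y <= walk_length G x p.
Proof.
move=> px ly ps; apply: ge_inf; last by exists p.
by exists 0 => _ [q [qx _ _ ->]]; exact: walk_length_ge0.
Qed.

(* A function that is 1-Lipschitz along the usable edges certifies a lower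
   bound; [p0] is needed because [inf] of the empty set is [0]. *)
Lemma dist_ge_potential s x y p0 (f : V -> R) :
  path (adj G) x p0 -> last x p0 = y -> {subset behead (belast x p0) <= s} ->
  x \in s ->
  (forall a b, adj G a b -> a \in s -> b \in y :: s -> f a - f b <= wt G a b) ->
  f x - f y <= dist G s x y.
Proof.
move=> p0x p0y p0s xs lip; apply: lb_le_inf.
  by exists (walk_length G x p0), p0.
move=> _ [p [px py ps ->]].
elim: p x px py ps xs {p0x p0y p0s} => [|z p IH] x /=; first by move=> _ ->; rewrite subrr.
move=> /andP[xz pz] py ps xs.
case: p => [|z' p'] in IH pz py ps *.
  by rewrite /= in py *; rewrite addr0 py; apply: lip; rewrite -?py // inE eqxx.
have zs : z \in s by apply: ps; rewrite /= inE eqxx.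
have := lip x z xz xs; rewrite inE zs orbT => /(_ isT) fxz.
have := IH z pz py; move=> /(_ _ zs) fz.
have -> : f x - f y = (f x - f z) + (f z - f y) by ring.
apply: lerD => //; apply: fz => t tp; apply: ps.
by move: tp; rewrite /= inE => ->; rewrite orbT.
Qed.

(** Each iteration explores a new vertex, so recursion on the number of unexplored vertices
    terminates. This fills in the parts of a run that need no control; their cost is only known to
    be nonnegative, which suffices for lower bounds. *)
Lemma run_completes d s v :
  exists s' c, [/\ run G d s v s' c, 0 <= c & {subset s <= s'}].
Proof.
have [m] := ubnP #|[predC s]|; elim: m s v => // m IH s v ltm.
have [[y [x q]]|noq] := pselect (exists y x, qualifies G d s v y x); last first.
  exists s, 0; split => //; apply: run_exit => y x; apply/negP => q; apply: noq.
  by exists y, x.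
have [bd _ _] := and3P q; have [adyx ys xs] := and3P bd.
have ltS (t : seq V) : {subset rcons s x <= t} -> (#|[predC t]| < #|[predC s]|)%N.
  move=> st; apply: proper_card; apply/properP; split.
    apply/fintype.subsetP => z; rewrite !inE; apply: contra => zs.
    by apply: st; rewrite mem_rcons inE zs orbT.
  by exists x; rewrite !inE // negbK st // mem_rcons inE eqxx.
have [s1 [c1 [r1 c10 ss1]]] := IH (rcons s x) x (leq_trans (ltS (rcons s x) (fun _ h => h)) ltm).
have [s2 [c2 [r2 c20 ss2]]] := IH s1 v (leq_trans (ltS _ ss1) ltm).
exists s2, (dist G s v y + wt G y x + c1 + dist G s1 x v + c2); split.
- exact: run_iter r1 r2.
- by rewrite !addr_ge0 ?dist_ge0 // wt_ge0.
- by move=> z zs; apply/ss2/ss1; rewrite mem_rcons inE zs orbT.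
Qed.

(* The recursion only ever goes deeper: the vertex [o_t] is explored by the
   call at [o_(t-1)]. Whatever happens after the last call costs at least 0. *)
Lemma run_deepening d (o : seq V) v0 (W : V -> R) T t C :
  (0 < t <= T)%N -> (T <= size o)%N ->
  (forall j, (t <= j < T)%N -> exists y,
     qualifies G d (take j o) (nth v0 o j.-1) y (nth v0 o j) /\
     W (nth v0 o j) <= wt G y (nth v0 o j)) ->
  (exists s c, run G d (take T o) (nth v0 o T.-1) s c /\ C <= c) ->
  exists s c, run G d (take t o) (nth v0 o t.-1) s c /\
    \sum_(t <= j < T) W (nth v0 o j) + C <= c.
Proof.
move=> /andP[t0 tT] To step [sT [cT [rT CT]]].
(* Induction from the deepest controlled call outwards, one enclosing call at a time. *)
have -> : t = (T - (T - t))%N by lia.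
have : (T - t <= T - t)%N by [].
elim: {-2}(T - t)%N => [|i IH] iT.
  by rewrite subn0; exists sT, cT; rewrite big_geq // add0r.
have [s1 [c1 [r1 C1]]] := IH (ltnW iT).
have := step (T - i.+1)%N; have -> : (t <= T - i.+1 < T)%N by lia.
set j := (T - i.+1)%N; move=> /(_ isT) [y [q Wj]].
have jE : (T - i)%N = j.+1 by rewrite /j; lia.
rewrite jE in r1 C1.
have jo : (j < size o)%N by rewrite /j; lia.
rewrite (take_nth v0) //= in r1.
have [s2 [c2 [r2 c20 _]]] := run_completes d s1 (nth v0 o j.-1).
have ad : adj G y (nth v0 o j) by case/and3P: q => /and3P[].
eexists s2, _; split; first exact: run_iter q r1 r2.
have jT : (j < T)%N by rewrite /j; lia.
rewrite (big_ltn jT) -addrA.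
have := wt_ge0 ad.
have := dist_ge0 (take j o) (nth v0 o j.-1) y.
have := dist_ge0 s1 (nth v0 o j) (nth v0 o j.-1).
lra.
Qed.

(** A closed walk around a spanning tree uses each tree edge twice. The tree is given by parents,
    and the decrease of [dep] excludes cycles. The walk itself is also returned, because [Opt_gt0]
    needs a nonempty set of tours. *)
Lemma Opt_le_tree (root : V) (par : V -> V) (dep : V -> nat) :
  (forall x, x != root -> adj G (par x) x /\ (dep (par x) < dep x)%N) ->
  (exists x p, [/\ path (adj G) x p, last x p = x & (forall z, z \in x :: p)]) /\
  Opt G <= 2 * \sum_(x | x != root) wt G (par x) x.
Proof.
move=> tree.
(* The subtree [A] grows by one vertex at a time, together with its tour [p]. *)
have ext k : (k < #|V|)%N -> exists (A : {set V}) p, [/\ root \in A, #|A| = k.+1,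
    path (adj G) root p /\ last root p = root, (forall z, z \in A -> z \in root :: p)
    & walk_length G root p = 2 * \sum_(x in A | x != root) wt G (par x) x].
  elim: k => [|k IH] kV.
    exists [set root]%SET, [::]; split => //=; rewrite ?inE ?cards1 //.
      by move=> z; rewrite !inE.
    by rewrite big1 ?mulr0 // => x /andP[]; rewrite inE => /eqP->; rewrite eqxx.
  have [A [p [rA cA [pr lr] Ap lenp]]] := IH (ltnW kV).
  have [x0 x0A] : exists x0, x0 \notin A.
    apply/existsP; rewrite -negb_forall; apply/negP => /forallP allA.
    have : #|A| = #|V| by apply: eq_card => z; rewrite allA.
    by rewrite cA => e; rewrite e ltnn in kV.
  (* A missing vertex of least depth has its parent in [A]. *)
  case: (@arg_minnP _ x0 (fun x => x \notin A) dep x0A) => x xA xmin.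
  have xr : x != root by apply: contraNneq xA => ->.
  have [apx dpx] := tree _ xr.
  have pA : par x \in A by apply: contraLR dpx => /xmin; rewrite -leqNgt.
  (* The tour is cut at a visit of [par x], where the detour to [x] and back is inserted. *)
  have [p1 [p2 defp lp1]] : exists p1, exists2 p2, p = p1 ++ p2 & last root p1 = par x.
    by have /splitPl := Ap _ pA; case=> p1 p2 <-; exists p1, p2.
  exists (x |: A)%SET, (p1 ++ [:: x, par x & p2]); split.
  - by rewrite inE rA orbT.
  - by rewrite cardsU1 xA cA.
  - subst p; move: pr lr; rewrite !cat_path !last_cat /= lp1 => /andP[-> ->] ->.
    by rewrite apx adj_sym apx.
  - move=> z; rewrite !inE => /orP[/eqP->|/Ap]; first by rewrite mem_cat !inE eqxx !orbT.
    by rewrite defp !(inE, mem_cat) => /or3P[] ->; rewrite ?orbT.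
  - rewrite (bigD1 x) /=; last by rewrite !inE eqxx.
    rewrite (eq_bigl (fun y => (y \in A) && (y != root))); last first.
      move=> y; rewrite !inE; case: (eqVneq y x) => [->|]; last by rewrite andbT.
      by rewrite (negbTE xA) andbF.
    move: lenp; rewrite defp !walk_length_cat /= lp1 (wt_sym apx).
    by rewrite mulrDr => lenp; rewrite -lenp; ring.
have V0 : (0 < #|V|)%N by apply/card_gt0P; exists root.
have [A [p [_ cA [pr lr] Ap lenp]]] := ext #|V|.-1 (ltac:(by rewrite prednK)).
have AT : A = [set: V]%SET.
  by apply/eqP; rewrite finset.eqEcard finset.subsetT cardsT cA prednK /=.
have pT z : z \in root :: p by apply: Ap; rewrite AT inE.
split; first by exists root, p.
have -> : 2 * \sum_(x | x != root) wt G (par x) x = walk_length G root p.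
  by rewrite lenp; congr (2 * _); apply: eq_bigl => x; rewrite AT inE.
apply: ge_inf; last by exists root, p.
by exists 0 => _ [x [q [px _ _ ->]]]; exact: walk_length_ge0.
Qed.

(** [Opt] is an infimum over infinitely many walks, so positivity of each length is not enough. A
    covering walk has at least one edge, which gives the uniform bound [mu], the least edge weight
    (capped at [1]). *)
Lemma Opt_gt0 : (1 < #|V|)%N ->
  (exists x p, [/\ path (adj G) x p, last x p = x & (forall z, z \in x :: p)]) ->
  (forall x y, adj G x y -> 0 < wt G x y) -> 0 < Opt G.
Proof.
move=> V2 [x0 [p0 [px0 lx0 cx0]]] w0.
pose mu := \big[Num.min/1]_(e : V * V | adj G e.1 e.2) wt G e.1 e.2.
have mu0 : 0 < mu.
  apply: (big_ind (fun r : R => 0 < r)) => //; last by move=> e; exact: w0.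
  by move=> a b a0 b0; rewrite lt_min a0.
apply: (lt_le_trans mu0); apply: lb_le_inf; first by exists (walk_length G x0 p0), x0, p0.
move=> _ [x [p [px lx cx ->]]].
case: p px lx cx => [_ _ cx|y p /= /andP[xy py] _ _].
  have : (#|V| <= size [:: x])%N by rewrite cardT; apply: uniq_leq_size (enum_uniq _) _ => z _; exact: cx.
  by rewrite leqNgt V2.
rewrite -[mu]addr0 lerD ?walk_length_ge0 //.
exact: (@bigmin_le_cond _ _ _ 1 (x, y)).
Qed.

(** [run_deepening] from the start vertex, with positions in [o] replaced by ranks. The calls are
    nested down to [vT], and [C] bounds the cost of the call there. *)
Lemma run_by_rank d (o : seq V) (rank : V -> nat) (W : V -> R) T v0 vT C :
  (T <= size o)%N -> (forall x, nth v0 o (rank x) = x) ->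
  (forall j, (j < size o)%N -> rank (nth v0 o j) = j) ->
  rank v0 = 0%N -> (rank vT).+1 = T ->
  (forall v x, (rank x < T)%N -> rank x = (rank v).+1 ->
     exists y, qualifies G d (take (rank x) o) v y x /\ W x <= wt G y x) ->
  (exists s c, run G d (take T o) vT s c /\ C <= c) ->
  exists c, Blocking_cost G d v0 c /\ \sum_(1 <= j < T) W (nth v0 o j) + C <= c.
Proof.
move=> To no ro r0 rT step fin.
have [] := @run_deepening d o v0 W T 1 C _ To.
- by rewrite -rT.
- move=> j /andP[j0 jT].
  have jo := leq_trans jT To.
  have := step (nth v0 o j.-1) (nth v0 o j).
  rewrite !ro //; last exact: leq_ltn_trans (leq_pred _) jo.
  by rewrite prednK // => /(_ jT erefl).
- by rewrite -rT /= no rT.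
- have o0 : (0 < size o)%N by rewrite (leq_trans _ To) // -rT.
  move=> s [c [r Cc]]; exists c; split => //; exists s; move: r.
  have n0 : nth v0 o 0 = v0 by have := no v0; rewrite r0.
  by rewrite (take_nth v0) // take0 /= n0.
Qed.

End Exploration.

(** * Orders of exploration and connectivity through spanning trees *)

Lemma rank_order (V : finType) (rank : V -> nat) :
  injective rank -> (forall x, (rank x < #|V|)%N) ->
  exists o : seq V, [/\ perm_eq o (enum V), size o = #|V|,
    forall x t, (x \in take t o) = (rank x < t)%N,
    forall v0 x, nth v0 o (rank x) = x &
    forall v0 j, (j < size o)%N -> rank (nth v0 o j) = j].
Proof.
move=> rinj rlt.
(* By counting, an injective rank with values below [#|V|] takes every such value. *)
have rE : perm_eq [seq rank x | x <- enum V] (iota 0 #|V|).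
  have ur : uniq [seq rank x | x <- enum V] by rewrite map_inj_uniq ?enum_uniq.
  have sub : {subset [seq rank x | x <- enum V] <= iota 0 #|V|}.
    by move=> _ /mapP[x _ ->]; rewrite mem_iota add0n rlt.
  have [|_ eqm] := uniq_min_size ur sub; first by rewrite size_iota size_map cardT.
  by apply: uniq_perm => //; exact: iota_uniq.
pose o := sort (relpre rank leq) (enum V).
have po : perm_eq o (enum V) by rewrite perm_sort.
have mo : [seq rank x | x <- o] = iota 0 #|V|.
  apply: (sorted_eq leq_trans anti_leq); last by rewrite (perm_trans (perm_map _ po)).
    by rewrite sorted_map sort_sorted // => x y; exact: leq_total.
  exact: iota_sorted.
have so : size o = #|V| by rewrite (perm_size po) cardT.
have ro v0 j : (j < size o)%N -> rank (nth v0 o j) = j.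
  by move=> jo; rewrite -(nth_map v0 0%N) // mo nth_iota -?so.
exists o; split => //.
- move=> x t; rewrite -(mem_map rinj) map_take mo take_iota mem_iota add0n leq0n /=.
  by rewrite leq_min rlt andbT.
- by move=> v0 x; apply: rinj; rewrite ro // so.
Qed.

Lemma connect_tree (V : finType) (e : rel V) (root : V) (par : V -> V) (dep : V -> nat) :
  symmetric e ->
  (forall x, x != root -> e (par x) x /\ (dep (par x) < dep x)%N) ->
  forall x y, connect e x y.
Proof.
move=> esym tree.
have cr x : connect e root x.
  have [n] := ubnP (dep x); elim: n x => // n IH x; rewrite ltnS => xn.
  have [->//|/tree[ex dx]] := eqVneq x root.
  by apply: connect_trans (IH _ (leq_trans dx xn)) (connect1 ex).
by move=> x y; apply: connect_trans (cr y); rewrite (sym_connect_sym esym).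
Qed.

(** * The broom *)

Section Broom.
Context (R : realType) (m k : nat).
Local Notation vertex := ('I_m.+1 + 'I_k)%type.

(** The path consists of the [inl i], and the leaves [inr j] hang on [inl ord0]. *)
Definition broom_adj : rel vertex := fun x y =>
  match x, y with
  | inl i, inl j => (i.+1 == j :> nat) || (j.+1 == i :> nat)
  | inl i, inr _ | inr _, inl i => i == 0 :> nat
  | inr _, inr _ => false
  end.

Definition broom_wt (x y : vertex) : R :=
  match x, y with inl _, inl _ => 1 | _, _ => 2 end.

Definition broom_parent (x : vertex) : vertex :=
  match x with inl i => inl (inord i.-1) | inr _ => inl ord0 end.

(** The order of exploration, path first; it also serves as the depth in the spanning tree. *)
Definition broom_rank (x : vertex) : nat :=
  match x with inl i => i | inr j => (m.+1 + j)%N end.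

Lemma broom_adj_sym : symmetric broom_adj.
Proof. by move=> [i|i] [j|j] //=; rewrite orbC. Qed.

Lemma broom_adj_irrefl : irreflexive broom_adj.
Proof. by move=> [i|i] //=; apply/negbTE; rewrite negb_or; lia. Qed.

Lemma broom_tree (x : vertex) : x != inl ord0 ->
  broom_adj (broom_parent x) x /\ (broom_rank (broom_parent x) < broom_rank x)%N.
Proof.
case: x => [i|j] //= i0.
have i1 : (0 < i)%N by rewrite lt0n; apply: contra i0 => /eqP i0; apply/eqP; congr inl; exact: val_inj.
have lti := ltn_ord i.
by rewrite inordK; lia.
Qed.

Lemma broom_wt_sym (x y : vertex) : broom_adj x y -> broom_wt x y = broom_wt y x.
Proof. by case: x y => [i|i] [j|j]. Qed.

Lemma broom_wt_ge1 (x y : vertex) : 1 <= broom_wt x y.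
Proof. by case: x y => [i|i] [j|j] //=; rewrite ler1n. Qed.

Lemma broom_wt_ge0 (x y : vertex) : broom_adj x y -> 0 <= broom_wt x y.
Proof. by move=> _; apply: le_trans (broom_wt_ge1 x y). Qed.

Definition broom : wgraph R vertex :=
  WGraph broom_adj_sym broom_adj_irrefl (connect_tree broom_adj_sym broom_tree)
    broom_wt_sym broom_wt_ge0.

Lemma broom_rank_inj : injective broom_rank.
Proof.
move=> [i|i] [j|j] /= ij; try (by congr inl; apply: val_inj);
  try (by congr inr; apply: val_inj => /=; lia).
  by have := ltn_ord i; lia.
by have := ltn_ord j; lia.
Qed.

Lemma broom_rank_lt (x : vertex) : (broom_rank x < #|{: vertex}|)%N.
Proof.
by rewrite card_sum !card_ord; case: x => [i|i] /=; have := ltn_ord i; lia.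
Qed.

Lemma broom_Opt_le : Opt broom <= 2 * (m.+1%:R + 2 * k%:R).
Proof.
have [_ le] := @Opt_le_tree _ _ broom _ _ _ broom_tree.
apply: le_trans le _; rewrite ler_pM2l ?ltr0n //.
rewrite big_mkcond /=.
apply: (@le_trans _ _ (\sum_(x : vertex) if x is inl _ then 1 else 2)).
  by apply: ler_sum => -[i|i] _ //=; case: ifP.
by rewrite big_sumType /= !sumr_const !card_ord -(mulr_natl 2 k) mulrC.
Qed.

Lemma broom_Opt_gt0 : (0 < k)%N -> 0 < Opt broom.
Proof.
move=> k0; apply: Opt_gt0.
- by rewrite card_sum !card_ord; lia.
- exact: (@Opt_le_tree _ _ broom _ _ _ broom_tree).1.
- by move=> x y _; apply: lt_le_trans (broom_wt_ge1 x y).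
Qed.

Lemma broom_path (i : nat) : (i <= m)%N -> exists p,
  [/\ path broom_adj (inl ord0) p, last (inl ord0) p = inl (inord i),
    forall z, z \in belast (inl ord0) p -> exists2 j : 'I_m.+1, z = inl j & (j < i)%N
  & walk_length broom (inl ord0) p = i%:R].
Proof.
elim: i => [_|i IH im].
  by exists [::]; split => //=; congr inl; apply: val_inj; rewrite /= inordK.
have [p [pp lp ip wp]] := IH (ltnW im).
exists (rcons p (inl (inord i.+1))); split.
- by rewrite rcons_path pp lp /= !inordK ?eqxx // ltnS ltnW.
- by rewrite last_rcons.
- move=> z; rewrite belast_rcons lastI mem_rcons inE lp => /orP[/eqP->|/ip[j -> ji]].
    by exists (inord i); rewrite // inordK // ltnS ltnW.
  by exists j => //; rewrite ltnS ltnW.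
- by rewrite -cats1 walk_length_cat wp lp /= addr0 -natr1.
Qed.

Lemma broom_dist_le (s : seq vertex) : (forall i : 'I_m.+1, (i < m)%N -> inl i \in s) ->
  dist broom s (inl ord0) (inl ord_max) <= m%:R.
Proof.
move=> sP; have [p [pp lp ip <-]] := broom_path (leqnn m).
apply: dist_le => //; first by rewrite lp; congr inl; apply: val_inj; rewrite /= inordK.
by move=> z /mem_behead /ip[j -> /sP].
Qed.

Lemma broom_dist_ge (s : seq vertex) (x : 'I_k) :
  (forall i : 'I_m.+1, inl i \in s) -> inr x \in s ->
  m%:R <= dist broom s (inr x) (inl ord_max).
Proof.
move=> sP xs; have [p [pp lp ip _]] := broom_path (leqnn m).
(* Distance to the far end along the path, constant across the leaf edges. *)
pose f (z : vertex) : R := if z is inl i then m%:R - (i : nat)%:R else m%:R.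
have -> : m%:R = f (inr x) - f (inl ord_max) by rewrite /=; ring.
apply: (@dist_ge_potential _ _ _ _ _ _ (inl ord0 :: p)) => //=.
- by rewrite lp; congr inl; apply: val_inj; rewrite /= inordK.
- by move=> z /ip[j -> _].
- move=> [i|i] [j|j] //= ij _ _.
  + by case/orP: ij => /eqP <-; rewrite -natr1; lra.
  + by rewrite (eqP ij); lra.
  + by rewrite (eqP ij); lra.
Qed.

Context (m0 : (0 < m)%N).

(** Every leaf is explored by the call at the far end [inl ord_max]. Only the way back from the leaf
    is counted, which costs at least [m]. *)
Lemma broom_cost d : m%:R <= 2 * (1 + d) ->
  exists c, Blocking_cost broom d (inl ord0) c /\ (k * m)%:R <= c.
Proof.
move=> md.
have [en [_ so mo no ro]] := rank_order broom_rank_inj broom_rank_lt.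
have card : #|{: vertex}| = (m.+1 + k)%N by rewrite card_sum !card_ord.
rewrite card in so.
(* Here [j] is the number of leaves still unexplored. *)
have phase2 j : (j <= k)%N -> exists s c,
    run broom d (take (m.+1 + (k - j)) en) (inl ord_max) s c /\ (j * m)%:R <= c.
  elim: j => [_|j IH jk].
    have [s [c [r c0 _]]] := run_completes broom d (take (m.+1 + (k - 0)) en) (inl ord_max).
    by exists s, c; split; rewrite ?mul0n.
  have [s [c [r cj]]] := IH (ltnW jk).
  have kjk : (k - j.+1 < k)%N by lia.
  pose x : 'I_k := Ordinal kjk.
  have rx : broom_rank (inr x) = (m.+1 + (k - j.+1))%N by [].
  have tk : take (m.+1 + (k - j)) en = rcons (take (m.+1 + (k - j.+1)) en) (inr x).
    have -> : (m.+1 + (k - j) = (m.+1 + (k - j.+1)).+1)%N by lia.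
    by rewrite (take_nth (inr x)) ?so; [rewrite -rx no | lia].
  (* After the path, all boundary edges are leaf edges of equal weight [2], so none blocks
     another. *)
  have leaf_bd t u z : (m.+1 <= t)%N -> boundary broom (take t en) u z ->
      u = inl ord0 /\ exists i, z = inr i.
    move=> mt /and3P[]; rewrite !mo; case: u z => [a|a] [b|b] //= ab _ bt.
    - by move: bt; rewrite (leq_trans (ltn_ord b)).
    - split; last by exists b.
      by congr inl; apply: val_inj; rewrite /= (eqP ab).
    - by move: bt; rewrite (leq_trans (ltn_ord b)).
  have q : qualifies broom d (take (m.+1 + (k - j.+1)) en) (inl ord_max) (inl ord0) (inr x).
    apply/and3P; split.
    - by rewrite /boundary !mo /=; lia.
    - apply/existsP => -[u /existsP[z /and4P[_ bz ltw _]]].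
      have [uE [i zE]] := leaf_bd _ _ _ (leq_addr _ _) bz.
      by move: ltw; rewrite uE zE /= ltxx.
    - apply/orP; right.
      have mlt : (m < size (take (m.+1 + (k - j.+1)) en))%N.
        by rewrite size_take so; case: ifP; lia.
      apply/existsP; exists (Ordinal mlt); apply/existsP.
      (* The moment is just before [inl ord_max] is explored: the last path edge has weight 1 < 2,
         and its end is within [m], hence within the reach [(1 + d) * 2] of the leaf edge. *)
      exists (inl (inord m.-1)); rewrite /= take_takel; last by lia.
      apply/and4P; split.
      + by rewrite /boundary !mo /=; lia.
      + by rewrite /boundary !mo /= inordK; lia.
      + by rewrite /= ltr1n.
      + rewrite mulrC; apply: le_trans (broom_dist_le _) md => i im.
        by rewrite mo.
  (* The call at a leaf stops at once: a leaf edge has weight [2] and never blocked another leaf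
     edge. *)
  have r1 : run broom d (rcons (take (m.+1 + (k - j.+1)) en) (inr x)) (inr x)
       (rcons (take (m.+1 + (k - j.+1)) en) (inr x)) 0.
    apply: run_exit => y z; rewrite -tk; apply/negP => /and3P[bz _].
    have [uE [i zE]] := leaf_bd _ _ _ (leq_addr _ _) bz.
    rewrite uE zE => /orP[//|/existsP[t /existsP[u /and4P[_ bx ltw _]]]].
    move: ltw; case/and3P: bx; case: u => [a|a] //= _ _ _.
    by rewrite ltxx.
  exists s; eexists; split.
    by apply: run_iter q r1 _; rewrite -tk; exact: r.
  have := dist_ge0 broom (take (m.+1 + (k - j.+1)) en) (inl ord_max) (inl ord0).
  rewrite -tk; have : m%:R <= dist broom (take (m.+1 + (k - j)) en) (inr x) (inl ord_max).
    apply: broom_dist_ge => [i|]; rewrite mo /=; last by lia.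
    by rewrite (leq_trans (ltn_ord i)) // leq_addr.
  by rewrite mulSn natrD; lra.
have [] := @run_by_rank _ _ broom d en broom_rank (fun=> 0) m.+1 (inl ord0) (inl ord_max) (k * m)%:R _ _ _ erefl erefl.
- by rewrite so leq_addr.
- by move=> x; exact: no.
- by move=> j; exact: ro.
(* Path edges have the least weight, so they are never blocked. *)
- move=> v [x|x] /= xm xv; last by lia.
  case: v xv => [v|v] /= xv; last by lia.
  exists (inl v); split => //.
  apply/and3P; split; last by rewrite eqxx.
    by rewrite /boundary !mo /=; lia.
  apply/existsP => -[u /existsP[z /and4P[_ bz ltw _]]].
  by move: ltw; rewrite /= ltNge broom_wt_ge1.
- by have := phase2 k (leqnn k); rewrite subnn addn0.
- by move=> c [bc]; rewrite big1_eq add0r => ?; exists c.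
Qed.

End Broom.

Lemma broom_ratio (R : realType) (d : R) (n m : nat) :
  (0 < m)%N -> (3 * m + 1 < n)%N -> m%:R <= 2 * (1 + d) ->
  ((m%:R / 8)%:E <= competitive_ratio d n)%E.
Proof.
move=> m0 mn md; pose k := (n - m.+1)%N.
have [c [bc cle]] := broom_cost k m0 md.
have k0 : (0 < k)%N by rewrite /k; lia.
have O0 := broom_Opt_gt0 R m k0.
apply: (@le_trans _ _ (c / Opt (broom R m k))%:E); last first.
  apply: ereal_sup_ubound; exists ('I_m.+1 + 'I_k)%type, (broom R m k), (inl ord0), c.
  by split => //; rewrite card_sum !card_ord /k; lia.
rewrite lee_fin ler_pdivlMr //; apply: le_trans cle.
have := broom_Opt_le R m k.
(* Hence [Opt] is at most [8 k], against a cost of at least [k m]. *)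
have mk : m.+1%:R <= 2 * k%:R :> R by rewrite -natrM ler_nat /k; lia.
have m1 : 0 <= m%:R :> R by rewrite ler0n.
rewrite natrM; nra.
Qed.

(** * Sparse hypergraphs *)

Section SparsePicks.
Local Open Scope nat_scope.
Implicit Types (s l : seq nat) (D L M : nat).

(** Blocks of [D] consecutive picks are the hyperedges. Positions beyond the end of [s] yield the
    default [0], which can only enlarge the set of numbers to avoid. *)
Definition same_block D s x : seq nat :=
  [seq nth 0 s (p %/ D * D + r) | p <- [seq p <- iota 0 (size s) | nth 0 s p == x],
                                  r <- iota 0 D].

(** The ball of radius [L] around the picks of the current, unfinished block; it is empty when a new
    block begins. *)
Fixpoint ball D s L : seq nat :=
  if L is L'.+1 then ball D s L' ++ flatten [seq same_block D s x | x <- ball D s L']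
  else drop (size s %/ D * D) s.

Lemma size_same_block D s x : size (same_block D s x) = count_mem x s * D.
Proof.
rewrite size_allpairs size_iota size_filter; congr (_ * _).
by rewrite -[in RHS](mkseq_nth 0 s) /mkseq count_map.
Qed.

(** A number occurs in at most [c] blocks of [D] picks, so each increase of the radius multiplies
    the size by at most [1 + c * D]. *)
Lemma size_ball D s L c : 0 < D -> (forall x, count_mem x s <= c) ->
  size (ball D s L) <= D * (1 + c * D) ^ L.
Proof.
move=> D0 cs; elim: L => [|L IH] /=.
  by rewrite size_drop muln1 leq_subLR; have := divn_eq (size s) D; have := ltn_pmod (size s) D0; lia.
have szfl l : size (flatten [seq same_block D s x | x <- l]) <= size l * (c * D).
  elim: l => //= x l IHl; rewrite size_cat size_same_block mulSn leq_add //.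
  by rewrite leq_mul2r cs orbT.
rewrite size_cat; apply: leq_trans (leq_add (leqnn _) (szfl _)) _.
rewrite -[X in X + _]muln1 -mulnDr expnSr mulnA.
by rewrite leq_mul2r IH orbT.
Qed.

Lemma sum_count_mem_uniq s l : uniq l -> \sum_(x <- l) count_mem x s <= size s.
Proof.
move=> ul; elim: s => [|a s IH] /=; first by rewrite big1_eq.
rewrite big_split /= -add1n leq_add //.
rewrite (eq_bigr (fun x => if x == a then 1 else 0)) => [|x _]; last by rewrite eq_sym; case: eqP.
by rewrite -big_mkcond sum1_count (count_uniq_mem a ul); case: (_ \in _).
Qed.

Lemma size_saturated s l c : uniq l ->
  size [seq x <- l | c <= count_mem x s] * c <= size s.
Proof.
move=> ul; apply: leq_trans (sum_count_mem_uniq s (filter_uniq (fun x => c <= count_mem x s) ul)).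
rewrite big_filter -sum1_size big_filter big_distrl /=.
by apply: leq_sum => x cx; rewrite mul1n.
Qed.

Definition spread M D L c s := forall t, t < size s ->
  [/\ nth 0 s t < M, count_mem (nth 0 s t) (take t s) < c
    & nth 0 s t \notin ball D (take t s) L].

Lemma spread_count M D L c s : spread M D L c s -> forall x, count_mem x s <= c.
Proof.
elim/last_ind: s => [//|s a IH] sp x.
have sps : spread M D L c s.
  move=> t ts; have := sp t; rewrite size_rcons ltnS (ltnW ts) nth_rcons ts => /(_ isT).
  by rewrite -cats1 takel_cat // ltnW.
rewrite -cats1 count_cat /= addn0.
have [ax|_] := eqVneq a x; last by rewrite addn0 IH.
have := sp (size s); rewrite size_rcons leqnn nth_rcons ltnn eqxx => /(_ isT) [_ + _].
by rewrite -cats1 take_size_cat // ax addn1.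
Qed.

(* Greedy choice: too few numbers are close to the current block or already
   used [c] times. *)
Lemma spread_exists M D L c N : 0 < D -> 0 < c ->
  N + c * (D * (1 + c * D) ^ L) < c * M ->
  exists s, size s = N /\ spread M D L c s.
Proof.
move=> D0 c0; elim: N => [|N IH] ltM; first by exists [::]; split.
have [s [sN sp]] := IH (leq_ltn_trans (leqnSn _ : N + _ <= _) ltM).
pose F := ball D s L ++ [seq x <- iota 0 M | c <= count_mem x s].
have [x xM xF] : exists2 x, x < M & x \notin F.
  have [/hasP[x]|] := boolP (has (fun x => x \notin F) (iota 0 M)).
    by rewrite mem_iota => ? ?; exists x.
  rewrite -all_predC => /allP sub.
  have : size (iota 0 M) <= size F.
    by apply: uniq_leq_size (iota_uniq _ _) _ => x /sub /=; rewrite negbK.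
  rewrite size_iota size_cat leqNgt => /negP[].
  (* Scaling by [c] avoids a division: [size s] bounds [c] times the number of saturated values. *)
  rewrite -(ltn_pmul2l c0) mulnDr.
  apply: leq_ltn_trans ltM; rewrite addnC leq_add //.
    apply: leq_trans (leqnSn _); rewrite -sN mulnC; apply: size_saturated; exact: iota_uniq.
  by rewrite leq_mul2l size_ball ?orbT //; apply: spread_count sp.
move: xF; rewrite mem_cat mem_filter mem_iota add0n xM leq0n !andbT negb_or -ltnNge => /andP[xb xc].
exists (rcons s x); rewrite size_rcons sN; split=> // t.
rewrite size_rcons ltnS leq_eqVlt => /orP[/eqP->|ts].
  by rewrite nth_rcons ltnn eqxx -cats1 take_size_cat.
by rewrite nth_rcons ts -cats1 (takel_cat _ (ltnW ts)); have := sp t ts.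
Qed.

Lemma ball_mono D s L L' : L <= L' -> {subset ball D s L <= ball D s L'}.
Proof.
elim: L' => [|L' IH]; first by rewrite leqn0 => /eqP->.
rewrite leq_eqVlt => /orP[/eqP-> //|/IH sub] x /sub.
by rewrite /= mem_cat => ->.
Qed.

(* [lev] is the truncated distance to the current block in the hypergraph whose
   edges are the blocks of [D] consecutive picks made before time [t]. *)
Lemma sparse_picks M D L c N : 0 < D -> 0 < c ->
  N + c * (D * (1 + c * D) ^ L) < c * M ->
  exists s : nat -> nat, forall t, t < N -> s t < M /\
    exists lev : nat -> nat,
    [/\ forall x, lev x <= L.+1,
        forall t', t' < t -> t' %/ D = t %/ D -> lev (s t') = 0,
        lev (s t) = L.+1 &
        forall t1 t2, t1 < t -> t2 < t -> t1 %/ D = t2 %/ D ->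
          lev (s t1) <= (lev (s t2)).+1].
Proof.
move=> D0 c0 ltM; have [s [sN sp]] := spread_exists D0 c0 ltM.
exists (nth 0 s) => t tN; have ts : t < size s by rewrite sN.
have [tM _ tb] := sp t ts; split => //.
(* The least radius whose ball contains [x]; [find] returns the length [L.+1] of the list if there
   is none, which is the truncation. *)
pose lev x := find (fun i => x \in ball D (take t s) i) (iota 0 L.+1).
have levL x : lev x <= L.+1 by rewrite -[X in _ <= X](size_iota 0) find_size.
have lev_in x : lev x <= L -> x \in ball D (take t s) (lev x).
  move=> xL; have := @nth_find _ 0 (fun i => x \in ball D (take t s) i) (iota 0 L.+1).
  by rewrite has_find size_iota ltnS xL nth_iota ?ltnS // add0n; apply.
have in_lev x i : x \in ball D (take t s) i -> lev x <= i.
  move=> xi; have [iL|/(leq_trans (levL x)) //] := ltnP i L.+1.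
  rewrite leqNgt; apply/negP => /(before_find 0).
  by rewrite nth_iota // add0n xi.
have szt : size (take t s) = t by rewrite size_takel // ltnW.
exists lev; split => //.
- move=> t' t't eqb; apply/eqP; rewrite -leqn0; apply: in_lev => /=.
  rewrite szt -(nth_take 0 t't) -eqb.
  have le : t' %/ D * D <= t' by rewrite leq_divM.
  have -> : nth 0 (take t s) t' = nth 0 (drop (t' %/ D * D) (take t s)) (t' - t' %/ D * D).
    by rewrite nth_drop subnKC.
  apply: mem_nth.
  rewrite size_drop szt ltn_sub2r //; exact: leq_ltn_trans t't.
- apply/eqP; rewrite eqn_leq levL /=; move: tb; apply: contraR; rewrite -leqNgt => /[dup] le /lev_in.
  exact: ball_mono.
- move=> t1 t2 t1t t2t eqb.
  have [t2L|] := leqP (lev (nth 0 s t2)) L; last first.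
    by move=> ?; apply: leq_trans (levL _) _; rewrite ltnW.
  (* The pick at [t1] shares the block of [t2], so it enters the ball one radius later at the
     latest. *)
  apply: in_lev; rewrite /= mem_cat; apply/orP; right.
  apply/flattenP; exists (same_block D (take t s) (nth 0 s t2)).
    by apply: map_f; exact: lev_in.
  apply/allpairsP; exists (t2, t1 %% D); split => /=.
  + by rewrite mem_filter nth_take // eqxx mem_iota szt.
  + by rewrite mem_iota ltn_pmod.
  + by rewrite -eqb -divn_eq nth_take.
Qed.

End SparsePicks.

(** * The high-girth instance *)

Lemma norm_natrB_le (R : realType) (a b c : nat) : (a <= c)%N -> (b <= c)%N ->
  `|a%:R - b%:R| <= c%:R :> R.
Proof.
rewrite -!(ler_nat R) => ac bc; have a0 := ler0n R a; have b0 := ler0n R b.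
by rewrite ler_norml; lra.
Qed.

Lemma norm_natr_half (R : realType) (a b : nat) : (a <= b <= a.+1)%N ->
  `|a%:R - (b%:R - 1 / 2)| <= 1 / 2 :> R.
Proof.
by rewrite -!(ler_nat R) -natr1 => /andP[ab ba]; rewrite ler_norml; lra.
Qed.

Lemma spine_rank_small (q v a b : nat) : (q.+1 + a + b <= q - v)%N = false.
Proof. by lia. Qed.

Lemma block_index_lt (D k k' a b : nat) : (k' < k)%N -> (a < D)%N ->
  (k' * D + a < k * D + b)%N.
Proof.
move=> kk aD; have : (k'.+1 * D <= k * D)%N by rewrite leq_mul2r kk orbT.
by rewrite mulSn; lia.
Qed.

Lemma sum_sum_prod (R : realType) (A B C : finType) (F : A + B * C -> R) :
  \sum_x F x = \sum_a F (inl a) + \sum_b \sum_c F (inr (b, c)).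
Proof.
rewrite big_sumType /= pair_bigA /=; congr (_ + _).
by apply: eq_bigr => -[].
Qed.

Section DenseGraph.
Context (R : realType) (d lam eta : R) (Q' J K D' L : nat) (S : nat -> nat).
Local Notation D := D'.+1.
Local Notation vertex := ('I_Q'.+1 + 'I_K * option 'I_D)%type.

Definition heavy (t : nat) : R := 1 + t%:R * eta.
Definition light (k : nat) : R := d * ((k * D)%:R * eta) + (1 + d) * (D%:R * eta).

(** The spine is [inl]; cluster [k] has leaves [inr (k, Some i)] and center [inr (k, None)]. The
    possible tails are the multiples of [J]: they are pairwise adjacent at weight [d], which under
    [lamJ] is also the length of the spine between consecutive ones. *)
Definition dense_adj : rel vertex := fun x y =>
  match x, y with
  | inl u, inl u' => [|| u.+1 == u' :> nat, u'.+1 == u :> nat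
                       | [&& u != u', (J %| u)%N & (J %| u')%N]]
  | inl u, inr (k, Some i) | inr (k, Some i), inl u => u == (S (k * D + i) * J)%N :> nat
  | inr (k, Some _), inr (k', None) | inr (k, None), inr (k', Some _) => k == k'
  | _, _ => false
  end.

Definition dense_wt (x y : vertex) : R :=
  match x, y with
  | inl u, inl u' => if (u.+1 == u' :> nat) || (u'.+1 == u :> nat) then lam else d
  | inl u, inr (k, Some i) | inr (k, Some i), inl u => heavy (k * D + i)
  | inr (k, _), inr _ => light k
  | _, _ => 0
  end.

(** The order of exploration. The spine is descended so that it ends at [0], a multiple of [J] and
    hence adjacent to every other tail; in a cluster the center comes last. *)
Definition dense_rank (x : vertex) : nat :=
  match x with
  | inl u => Q' - u
  | inr (k, Some i) => Q'.+1 + k * D.+1 + i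
  | inr (k, None) => Q'.+1 + k * D.+1 + D
  end.

(** A spanning tree with a single heavy edge per cluster, the one at leaf [0]. *)
Definition dense_parent (x : vertex) : vertex :=
  match x with
  | inl u => inl (inord u.-1)
  | inr (k, Some i) => if i == 0 :> nat then inl (inord (S (k * D) * J)) else inr (k, None)
  | inr (k, None) => inr (k, Some ord0)
  end.

Definition dense_depth (x : vertex) : nat :=
  match x with
  | inl u => u
  | inr (k, Some i) => if i == 0 :> nat then Q'.+1 else Q'.+3
  | inr (k, None) => Q'.+2
  end.

(** [Slev] is what [sparse_picks] provides. By [dL], passing through [L.+1] clusters, at two heavy
    edges each, is no shortcut compared with a spine distance [d]. *)
Context (d0 : 0 < d) (lam0 : 0 < lam) (lam1 : lam < 1) (lamd : lam <= d)
  (lamJ : lam * J%:R = d) (J0 : (0 < J)%N) (eta0 : 0 < eta)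
  (eta_small : (1 + d) * ((K * D * D.+1)%:R * eta) <= 1)
  (SQ : forall t, (t < K * D)%N -> (S t * J <= Q')%N)
  (dL : d <= 2 * L.+1%:R)
  (Slev : forall t, (t < K * D)%N -> exists lev : nat -> nat,
    [/\ forall x, (lev x <= L.+1)%N,
        forall t', (t' < t)%N -> (t' %/ D = t %/ D)%N -> lev (S t') = 0%N,
        lev (S t) = L.+1 &
        forall t1 t2, (t1 < t)%N -> (t2 < t)%N -> (t1 %/ D = t2 %/ D)%N ->
          (lev (S t1) <= (lev (S t2)).+1)%N]).

Lemma heavy_le t t' : (t <= t')%N -> heavy t <= heavy t'.
Proof. by move=> tt; rewrite lerD2l ler_pM2r // ler_nat. Qed.

Lemma heavy_lt t t' : (t < t')%N -> heavy t < heavy t'.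
Proof. by move=> tt; rewrite ltrD2l ltr_pM2r // ltr_nat. Qed.

Lemma heavy_ge1 t : 1 <= heavy t.
Proof. by rewrite lerDl mulr_ge0 // ltW. Qed.

Lemma light_gt0 k : 0 < light k.
Proof.
rewrite ltr_wpDl // ?mulr_gt0 ?ltr0n ?addr_gt0 //.
by rewrite !mulr_ge0 // ltW.
Qed.

(** The factor [D.+1] is the number of vertices of a cluster, each of which is charged [light k] in
    [dense_Opt_le]. *)
Lemma light_le k : (k < K)%N -> light k * D.+1%:R <= 1.
Proof.
move=> kK; apply: le_trans eta_small.
have : (k * D + D)%:R <= (K * D)%:R :> R by rewrite ler_nat -mulSnr leq_mul2r kK orbT.
rewrite /light !natrM natrD natrM => le.
have D1 : 0 <= D.+1%:R :> R by [].
set a := k%:R * D%:R in le *; set b := K%:R * D%:R in le *.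
have a0 : 0 <= a by rewrite mulr_ge0.
have -> : (1 + d) * (b * D.+1%:R * eta) = ((1 + d) * (b * eta)) * D.+1%:R by ring.
rewrite ler_wpM2r // .
have : a * eta + D%:R * eta <= b * eta by rewrite -mulrDl ler_pM2r.
have : 0 <= a * eta by rewrite mulr_ge0 // ltW.
have := d0; nra.
Qed.

Lemma light_lt1 k : (k < K)%N -> light k < 1.
Proof.
move=> kK; have := light_le kK; have := light_gt0 k.
have : 2 <= D.+1%:R :> R by rewrite ler_nat.
nra.
Qed.

(* The choice of [light k]: the center of cluster [k] is slightly out of reach
   for the heavy edges of that cluster, and just within reach for the first
   heavy edge of the next one. *)
Lemma light_heavy k : d + heavy (k * D) + light k = (1 + d) * heavy (k.+1 * D).
Proof. by rewrite /light /heavy mulSn natrD; ring. Qed.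

Lemma index_lt (k : 'I_K) i : (i < D)%N -> (k * D + i < K * D)%N.
Proof.
move=> iD; have kK := ltn_ord k; apply: (@leq_trans (k.+1 * D)); first by rewrite mulSn; lia.
by rewrite leq_mul2r kK orbT.
Qed.

Lemma tail_inord (k : 'I_K) i : (i < D)%N ->
  (inord (S (k * D + i) * J) : 'I_Q'.+1) = (S (k * D + i) * J)%N :> nat.
Proof. by move=> iD; rewrite inordK // ltnS; apply/SQ/index_lt. Qed.

Lemma dense_adj_sym : symmetric dense_adj.
Proof.
move=> [u|[k [i|]]] [v|[l [j|]]] //=; try exact: eq_sym.
by rewrite orbCA [u == v]eq_sym [(J %| u)%N && _]andbC.
Qed.

Lemma dense_adj_irrefl : irreflexive dense_adj.
Proof. by move=> [u|[k [i|]]] //=; rewrite eqxx /=; lia. Qed.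

Lemma dense_wt_sym (x y : vertex) : dense_adj x y -> dense_wt x y = dense_wt y x.
Proof.
move: x y => [u|[k [i|]]] [v|[l [j|]]] //=; first by move=> _; rewrite orbC.
  by move=> /eqP->.
by move=> /eqP->.
Qed.

Lemma dense_wt_gt0 (x y : vertex) : dense_adj x y -> 0 < dense_wt x y.
Proof.
have h0 t : 0 < heavy t by apply: lt_le_trans (heavy_ge1 t).
by move: x y => [u|[k [i|]]] [v|[l [j|]]] //= _; rewrite ?light_gt0 ?h0 //; case: ifP.
Qed.

Lemma dense_wt_ge0 (x y : vertex) : dense_adj x y -> 0 <= dense_wt x y.
Proof. by move/dense_wt_gt0/ltW. Qed.

Lemma dense_tree (x : vertex) : x != inl ord0 ->
  dense_adj (dense_parent x) x /\ (dense_depth (dense_parent x) < dense_depth x)%N.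
Proof.
case: x => [u|[k [i|]]] /=.
- move=> u0; have u1 : (0 < u)%N.
    by rewrite lt0n; apply: contra u0 => /eqP u0; apply/eqP; congr inl; exact: val_inj.
  have := ltn_ord u => uQ; rewrite inordK; last by lia.
  by split; [apply/orP; left; lia | lia].
- move=> _; case: (eqVneq (i : nat) 0%N) => [i0|i0] /=.
    have := tail_inord k (ltn0Sn D'); rewrite addn0 => e; rewrite e i0 addn0 eqxx; split => //.
    by rewrite -e ltn_ord.
  by rewrite eqxx; split => //; rewrite (negbTE i0).
- by move=> _; rewrite eqxx.
Qed.

Definition dense : wgraph R vertex :=
  WGraph dense_adj_sym dense_adj_irrefl (connect_tree dense_adj_sym dense_tree)
    dense_wt_sym dense_wt_ge0.

Lemma dense_card : #|{: vertex}| = (Q'.+1 + K * D.+1)%N.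
Proof. by rewrite card_sum card_prod card_option !card_ord. Qed.

Lemma dense_rank_block (k k' i i' : nat) : (i <= D)%N -> (i' <= D)%N ->
  (Q'.+1 + k * D.+1 + i <= Q'.+1 + k' * D.+1 + i')%N =
  (k < k')%N || (k == k') && (i <= i')%N.
Proof.
move=> iD iD'; case: (ltngtP k k') => kk /=.
- have : (k.+1 * D.+1 <= k' * D.+1)%N by rewrite leq_mul2r kk orbT.
  by rewrite mulSn; lia.
- have : (k'.+1 * D.+1 <= k * D.+1)%N by rewrite leq_mul2r kk orbT.
  by rewrite mulSn; lia.
- by rewrite kk leq_add2l.
Qed.

Lemma dense_rank_tail_lt (k k' : 'I_K) (i j : 'I_D) :
  (dense_rank (inr (k', Some j)) < dense_rank (inr (k, Some i)))%N ->
  (k' < k)%N \/ k' = k /\ (j < i)%N.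
Proof.
rewrite /= ltnNge dense_rank_block ?(ltnW (ltn_ord i)) ?(ltnW (ltn_ord j)) //.
move=> h; have [|kk] := ltnP k' k; [by left | right].
by split; [apply: val_inj => /=; lia | lia].
Qed.

Lemma dense_rank_inj : injective dense_rank.
Proof.
have blk (k k' : 'I_K) i i' : (i <= D)%N -> (i' <= D)%N ->
    (Q'.+1 + k * D.+1 + i = Q'.+1 + k' * D.+1 + i')%N -> k = k' /\ i = i'.
  move=> iD iD' e.
  have := dense_rank_block k k' iD iD'; have := dense_rank_block k' k iD' iD.
  rewrite e leqnn => /esym h1 /esym h2.
  by split; [apply: val_inj => /=; lia | lia].
move=> [u|[k [i|]]] [v|[l [j|]]] /= e.
- by congr inl; apply: val_inj; have := ltn_ord u; have := ltn_ord v; rewrite /=; lia.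
- lia.
- lia.
- lia.
- have [-> ij] := blk _ _ _ _ (ltnW (ltn_ord i)) (ltnW (ltn_ord j)) e.
  by congr (inr (_, Some _)); exact: val_inj.
- by have [_ ij] := blk _ _ _ _ (ltnW (ltn_ord i)) (leqnn D) e; have := ltn_ord i; lia.
- lia.
- by have [_ ij] := blk _ _ _ _ (leqnn D) (ltnW (ltn_ord j)) e; have := ltn_ord j; lia.
- by have [-> _] := blk _ _ _ _ (leqnn D) (leqnn D) e.
Qed.

Lemma dense_rank_cluster (k : 'I_K) c : (Q' < dense_rank (inr (k, c)))%N.
Proof. by case: c => [i|] /=; rewrite -addnA ltn_addr. Qed.

Lemma dense_rank_lt (x : vertex) : (dense_rank x < #|{: vertex}|)%N.
Proof.
rewrite dense_card; case: x => [u|[k i]] /=; first by lia.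
have : (k.+1 * D.+1 <= K * D.+1)%N by rewrite leq_mul2r (ltn_ord k) orbT.
by rewrite mulSn; case: i => [i|]; [have := ltn_ord i|]; lia.
Qed.

(** * The run on the high-girth instance *)

Section Run.
Context (o : seq vertex)
  (mo : forall x t, (x \in take t o) = (dense_rank x < t)%N)
  (so : size o = #|{: vertex}|).

Lemma inl_explored (u : 'I_Q'.+1) t : (Q' < t)%N -> inl u \in take t o.
Proof. by move=> Qt; rewrite mo /=; lia. Qed.

(** Heavy edges are traversed by increasing weight and earlier clusters are finished, so the only
    lighter edges left lead to the center of the current cluster. *)
Lemma boundary_dense (k : 'I_K) i u z : (i <= D)%N ->
  boundary dense (take (Q'.+1 + k * D.+1 + i) o) u z ->
  heavy (k * D + i) <= dense_wt u z \/
  exists2 j : 'I_D, (j < i)%N & u = inr (k, Some j) /\ z = inr (k, None).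
Proof.
move=> iD /and3P[]; rewrite !mo -leqNgt.
case: u z => [u|[l [j|]]] [v|[l' [j'|]]] //=.
- by move=> _ _; rewrite spine_rank_small.
- move=> _ _; rewrite dense_rank_block ?(ltnW (ltn_ord j')) // => le.
  left; apply: heavy_le; case/orP: le => [kl|/andP[/eqP-> //]]; last by rewrite leq_add2l.
  have : (k.+1 * D <= l' * D)%N by rewrite leq_mul2r kl orbT.
  by rewrite mulSn; lia.
- by move=> _ _; rewrite spine_rank_small.
- move=> /eqP <-; rewrite ltnNge !dense_rank_block ?(ltnW (ltn_ord j)) //.
  move=> ji ki; right; exists j; first by have := ltn_ord j; lia.
  by have -> : k = l by apply: val_inj => /=; have := ltn_ord j; lia.
- move=> /eqP <-; have := ltn_ord j'; lia.
Qed.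

Lemma dense_wt_inl_le (u v : 'I_Q'.+1) : dense_wt (inl u) (inl v) <= d.
Proof. by rewrite /=; case: ifP. Qed.

Lemma tail_path (b : 'I_Q'.+1) (k : 'I_K) (j : 'I_D) : (J %| b)%N ->
  exists p, [/\ path dense_adj (inl b) p, last (inl b) p = inr (k, Some j),
    {subset behead (belast (inl b) p) <= [pred x : vertex | if x is inl _ then true else false]},
    inr (k, Some j) \in p
  & walk_length dense (inl b) p <= d + heavy (k * D + j)].
Proof.
move=> Jb; pose b' : 'I_Q'.+1 := inord (S (k * D + j) * J).
have b'E : b' = (S (k * D + j) * J)%N :> nat by exact: tail_inord.
have [bb|bb] := eqVneq b b'.
  exists [:: inr (k, Some j)]; split => //=; rewrite ?inE ?eqxx //.
    by rewrite bb b'E eqxx.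
  by rewrite addr0 lerDr ltW.
exists [:: inl b'; inr (k, Some j)]; split; rewrite ?inE ?eqxx ?orbT //.
- by rewrite /= bb Jb b'E dvdn_mull // eqxx !orbT.
- by move=> z; rewrite /= inE => /eqP->.
- by rewrite /= addr0 lerD2r; have := dense_wt_inl_le b b'.
Qed.

Lemma dist_tail_le (b : 'I_Q'.+1) (k : 'I_K) (j : 'I_D) t : (J %| b)%N -> (Q' < t)%N ->
  dist dense (take t o) (inl b) (inr (k, Some j)) <= d + heavy (k * D + j).
Proof.
move=> Jb Qt; have [p [pp lp ip _ wp]] := tail_path k j Jb.
apply: le_trans wp; apply: dist_le => // z /ip; case: z => // u _.
exact: inl_explored.
Qed.

Lemma center_path (b : 'I_Q'.+1) (k : 'I_K) t : (J %| b)%N ->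
  (dense_rank (inr (k, Some ord0)) < t)%N ->
  exists p, [/\ path dense_adj (inl b) p, last (inl b) p = inr (k, None),
    {subset behead (belast (inl b) p) <= take t o}
  & walk_length dense (inl b) p <= d + heavy (k * D) + light k].
Proof.
move=> Jb rt; have [p [pp lp ip kp wp]] := tail_path k ord0 Jb.
have Qt : (Q' < t)%N := ltn_trans (dense_rank_cluster _ _) rt.
exists (rcons p (inr (k, None))); split.
- by rewrite rcons_path pp lp /= eqxx.
- by rewrite last_rcons.
- rewrite belast_rcons /= => z; case: p pp lp ip kp wp => // a p pp lp ip kp wp.
  rewrite lastI mem_rcons inE -[last a p]/(last (inl b) (a :: p)) lp.
  move=> /orP[/eqP->|/ip]; first by rewrite mo.
  by case: z => // u _; exact: inl_explored.
- rewrite -cats1 walk_length_cat lp /= addr0.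
  by move: wp; rewrite addn0; lra.
Qed.

Lemma dist_center_le (b : 'I_Q'.+1) (k : 'I_K) t : (J %| b)%N ->
  (dense_rank (inr (k, Some ord0)) < t)%N ->
  dist dense (take t o) (inl b) (inr (k, None)) <= (1 + d) * heavy (k.+1 * D).
Proof.
move=> Jb rt; have [p [pp lp ip wp]] := center_path Jb rt.
by rewrite -light_heavy; apply: le_trans wp; exact: dist_le.
Qed.

(** Linear interpolation of [lev] between consecutive multiples of [J]. *)
Definition spine_potential (lev : nat -> nat) (u : nat) : R :=
  let q := (u %/ J)%N in (lev q)%:R + ((lev q.+1)%:R - (lev q)%:R) * ((u %% J)%N%:R / J%:R).

Lemma spine_potential_mul lev a : spine_potential lev (a * J) = (lev a)%:R.
Proof. by rewrite /spine_potential mulnK // modnMl !mul0r mulr0 addr0. Qed.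

Lemma spine_potential_step lev u : (forall a, (lev a <= L.+1)%N) ->
  `|spine_potential lev u.+1 - spine_potential lev u| <= L.+1%:R / J%:R.
Proof.
move=> levL; pose q := (u %/ J)%N; pose r := (u %% J)%N.
have JR : J%:R != 0 :> R by rewrite pnatr_eq0 -lt0n.
have JP : 0 < J%:R :> R by rewrite ltr0n.
have uE : u = (q * J + r)%N by exact: divn_eq.
have rJ : (r < J)%N by rewrite ltn_mod.
have -> : spine_potential lev u.+1 - spine_potential lev u =
    ((lev q.+1)%:R - (lev q)%:R) / J%:R.
  rewrite {2}/spine_potential -/q -/r.
  have [rJ'|rJ'] := ltnP r.+1 J.
    rewrite /spine_potential uE -addnS divnMDl // divn_small // addn0 modnMDl modn_small //.
    by rewrite -natr1; field.
  have -> : u.+1 = (q.+1 * J)%N by rewrite uE mulSn; clear -rJ rJ'; clearbody r; lia.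
  rewrite spine_potential_mul.
  have -> : r%:R = J%:R - 1 :> R by apply/eqP; rewrite -subr_eq opprK natr1 eqr_nat eqn_leq rJ rJ'.
  by field.
rewrite normrM normfV (gtr0_norm JP) ler_pM2r ?invr_gt0 //.
exact: norm_natrB_le.
Qed.

(* Lower bound by the potential which is [0] at the center of cluster [k],
   and on the spine is an affine function of the truncated hypergraph distance
   [lev] to the tails of the explored part of cluster [k]. *)
Lemma dist_center_gt (k : 'I_K) (i : 'I_D) (b : 'I_Q'.+1) : (0 < i)%N ->
  b = (S (k * D + i) * J)%N :> nat ->
  (1 + d) * heavy (k * D + i) <
    dist dense (take (dense_rank (inr (k, Some i))) o) (inl b) (inr (k, None)).
Proof.
move=> i0 bE.
have tKD : (k * D + i < K * D)%N by apply: index_lt.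
have [lev [levL lev0 levt levb]] := Slev tKD.
(* With this scale the levels [0] to [L.+1] span exactly [d], and the slope along the spine is at
   most [lam]. *)
pose gam : R := d / L.+1%:R.
have L0 : 0 < L.+1%:R :> R by rewrite ltr0n.
have gam0 : 0 < gam by rewrite divr_gt0.
have gamL : gam * L.+1%:R = d by rewrite mulfVK ?gt_eqF.
have gam2 : gam <= 2 by rewrite ler_pdivrMr.
(* The tails of an earlier cluster have at most two consecutive levels; halfway between them, at
   [hi k' - 1 / 2], the potential of the cluster differs from that of each tail by at most
   [gam / 2 <= 1]. *)
pose hi (k' : nat) := (\max_(j < D) lev (S (k' * D + j)))%N.
have hiP (k' : 'I_K) (j : 'I_D) : (k' < k)%N ->
    (lev (S (k' * D + j)) <= hi k' <= (lev (S (k' * D + j))).+1)%N.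
  move=> kk; have bd (j' : 'I_D) : (k' * D + j' < k * D + i)%N by exact: block_index_lt.
  rewrite (leq_bigmax (F := fun j : 'I_D => lev (S (k' * D + j))) j) /=.
  by apply/bigmax_leqP => j' _; apply: levb; rewrite ?bd // !divnMDl // !divn_small.
pose base := light k + heavy (k * D).
pose f (x : vertex) : R := match x with
  | inl u => base + gam * spine_potential lev u
  | inr (k', c) => if (k' < k)%N then base + gam * ((hi k')%:R - 1 / 2)
                   else if c is Some _ then light k else 0
  end.
(* As [0 < i], leaf [0] is explored, so some usable path to the center exists. *)
have rk0 : (dense_rank (inr (k, Some ord0)) < dense_rank (inr (k, Some i)))%N.
  by rewrite /= ltn_add2l.
have Jb : (J %| b)%N by rewrite bE dvdn_mull.
have [p [pp lp ip _]] := center_path Jb rk0.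
have := @dist_ge_potential _ _ dense _ _ _ p f pp lp ip.
have Qt : (Q' < dense_rank (inr (k, Some i)))%N by exact: dense_rank_cluster.
rewrite inl_explored // => /(_ isT) H.
apply: lt_le_trans (H _).
  rewrite /= bE spine_potential_mul levt ltnn gamL subr0 /base.
  (* The new tail has level [L.+1], so its potential is [base + d]. *)
  have -> : light k + heavy (k * D) + d = (1 + d) * heavy (k.+1 * D).
    by rewrite -light_heavy; ring.
  rewrite ltr_pM2l ?addr_gt0 //.
  by apply: heavy_lt; rewrite mulSn addnC ltn_add2r.
have spineV (u v : 'I_Q'.+1) : dense_adj (inl u) (inl v) ->
    `|f (inl u) - f (inl v)| <= dense_wt (inl u) (inl v).
  have step (w : nat) : `|gam * spine_potential lev w.+1 - gam * spine_potential lev w| <= lam.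
    rewrite -mulrBr normrM (gtr0_norm gam0).
    apply: le_trans (ler_wpM2l (ltW gam0) (spine_potential_step w levL)) _.
    by rewrite mulrA gamL -lamJ mulfK // pnatr_eq0 -lt0n.
  rewrite /= opprD addrACA subrr add0r => uv.
  case: ifP => [/orP[/eqP <-|/eqP <-]|nc]; rewrite 1?distrC //; first by rewrite distrC.
  have /and3P[_ /dvdnP[m ->] /dvdnP[m' ->]] : [&& u != v, (J %| u)%N & (J %| v)%N].
    by move: uv; rewrite orbA nc.
  rewrite !spine_potential_mul -mulrBr normrM (gtr0_norm gam0) -gamL ler_pM2l //.
  exact: norm_natrB_le.
have tailV (k' : 'I_K) (j : 'I_D) (u : 'I_Q'.+1) : u = (S (k' * D + j) * J)%N :> nat ->
    (dense_rank (inr (k', Some j)) < dense_rank (inr (k, Some i)))%N ->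
    `|f (inl u) - f (inr (k', Some j))| <= heavy (k' * D + j).
  move=> uE /dense_rank_tail_lt [kk|[kk ji]]; rewrite /= uE spine_potential_mul.
    rewrite kk opprD addrACA subrr add0r -mulrBr normrM (gtr0_norm gam0).
    apply: le_trans (heavy_ge1 _).
    apply: le_trans (ler_wpM2l (ltW gam0) (norm_natr_half _ (hiP k' j kk))) _.
    by rewrite mul1r ler_pdivrMr // mul1r.
  rewrite kk ltnn lev0 ?mulr0 ?addr0; last 2 first.
  - by rewrite ltn_add2l.
  - by rewrite !divnMDl // !divn_small.
  rewrite /base [light k + _]addrC addrK ger0_norm; last by apply: le_trans (heavy_ge1 _).
  by apply: heavy_le; rewrite leq_addr.
(* Light edges are flat in earlier clusters, and in cluster [k] they change the potential by
   [light k]. *)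
move=> [u|[k1 [j1|]]] [v|[k2 [j2|]]] adjac; rewrite inE ?mo; cbn [eq_op] => ha hc //.
- exact: le_trans (ler_norm _) (spineV _ _ adjac).
- case/orP: hc => [/eqP //|hc].
  exact: le_trans (ler_norm _) (tailV _ _ _ (eqP adjac) hc).
- by apply: le_trans (ler_norm _) _; rewrite distrC; exact: tailV (eqP adjac) ha.
- have -> : k2 = k1 by rewrite (eqP (adjac : k1 == k2)).
  have [kk|[-> _]] := dense_rank_tail_lt ha; rewrite /= ?kk ?ltnn ?subrr ?subr0 //.
  by rewrite ltW // light_gt0.
- case/orP: hc => [/eqP //|hc].
  have -> : k1 = k2 by rewrite (eqP (adjac : k1 == k2)).
  have [kk|[kk ji]] := dense_rank_tail_lt hc; rewrite /= ?kk ?ltnn ?subrr.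
    by rewrite ltW // light_gt0.
  by rewrite sub0r (le_trans _ (ltW (light_gt0 k))) // oppr_le0 ltW // light_gt0.
Qed.

(** The blocking is witnessed at time [dense_rank v], when [v] is the next vertex to be explored. *)
Lemma earlier_blocked_at (v y x u' : vertex) : (dense_rank v < dense_rank x)%N ->
  blocks dense d (take (dense_rank v) o) u' v y x ->
  earlier_blocked_via dense d (take (dense_rank x) o) v y x.
Proof.
move=> vx bl; have vs : (dense_rank v < size (take (dense_rank x) o))%N.
  by rewrite size_takel // so ltnW // dense_rank_lt.
apply/existsP; exists (Ordinal vs); apply/existsP; exists u'.
by rewrite /= take_takel // ltnW.
Qed.

Lemma heavy_not_blocked (k : 'I_K) (i : 'I_D) (b : 'I_Q'.+1) :
  b = (S (k * D + i) * J)%N :> nat ->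
  ~~ blocked dense d (take (dense_rank (inr (k, Some i))) o) (inl b) (inr (k, Some i)).
Proof.
move=> bE; apply/existsP => -[u /existsP[z /and4P[_ bz ltw le]]].
have wE : wt dense (inl b) (inr (k, Some i)) = heavy (k * D + i) by [].
have [|[j ji [uE zE]]] := boundary_dense (ltnW (ltn_ord i)) bz.
  by rewrite leNgt -wE ltw.
have i0 : (0 < i)%N by apply: leq_ltn_trans ji.
have := dist_center_gt i0 bE; rewrite ltNge => /negP[].
by move: le; rewrite zE wE.
Qed.

Lemma dense_rank_pred (k : 'I_K) (i : 'I_D) (v : vertex) :
  dense_rank (inr (k, Some i)) = (dense_rank v).+1 ->
  [\/ exists2 j : 'I_D, j.+1 = i & v = inr (k, Some j),
      exists2 l : 'I_K, l.+1 = k & i = 0 :> nat /\ v = inr (l, None)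
    | [/\ k = 0 :> nat, i = 0 :> nat & v = inl ord0]]%N.
Proof.
move=> rv; have [i0|i0] := posnP i; last first.
  have iD : (i.-1 < D)%N by apply: leq_ltn_trans (leq_pred _) (ltn_ord i).
  constructor 1; exists (Ordinal iD); first exact: prednK.
  by apply: dense_rank_inj; move: rv => /=; lia.
have [k0|k0] := posnP k; last first.
  have kK : (k.-1 < K)%N by apply: leq_ltn_trans (leq_pred _) (ltn_ord k).
  constructor 2; exists (Ordinal kK); first exact: prednK.
  split => //; apply: dense_rank_inj; move: rv; rewrite /= i0.
  by rewrite -{1}(prednK k0) mulSn; lia.
constructor 3; split => //; apply: dense_rank_inj; move: rv.
by rewrite /= i0 k0; lia.
Qed.

Lemma inl_boundary (k : 'I_K) (i : 'I_D) (b : 'I_Q'.+1) t :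
  b = (S (k * D + i) * J)%N :> nat -> (dense_rank (inl b) < t)%N ->
  (t <= dense_rank (inr (k, Some i)))%N ->
  boundary dense (take t o) (inl b) (inr (k, Some i)).
Proof. by move=> bE bt ti; rewrite /boundary !mo bt -leqNgt ti /= bE eqxx. Qed.

(** The edge by which the preceding vertex [v] was explored is lighter and was within reach, except
    when [b] is itself the current position. *)
Lemma heavy_reachable (k : 'I_K) (i : 'I_D) (b : 'I_Q'.+1) (v : vertex) :
  b = (S (k * D + i) * J)%N :> nat ->
  dense_rank (inr (k, Some i)) = (dense_rank v).+1 ->
  (inl b == v) || earlier_blocked_via dense d (take (dense_rank (inr (k, Some i))) o)
                    v (inl b) (inr (k, Some i)).
Proof.
move=> bE rv; have Jb : (J %| b)%N by rewrite bE dvdn_mull.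
have vlt : (dense_rank v < dense_rank (inr (k, Some i)))%N by rewrite rv.
have wE : wt dense (inl b) (inr (k, Some i)) = heavy (k * D + i) by [].
have rb : (dense_rank (inl b) <= Q')%N by exact: leq_subr.
have [[j ji vE]|[l lk [i0 vE]]|[k0 i0 vE]] := dense_rank_pred rv; rewrite vE in vlt *.
(* Blocked by the previous heavy edge of the same cluster. *)
- apply/orP; right; apply: (@earlier_blocked_at _ _ _ (inl (inord (S (k * D + j) * J)))) => //.
  have b'E := tail_inord k (ltn_ord j).
  have hlt : heavy (k * D + j) < heavy (k * D + i).
    by apply: heavy_lt; rewrite ltn_add2l ji.
  apply/and4P; split.
  + by apply: inl_boundary (ltnW vlt) => //; apply: leq_ltn_trans rb (dense_rank_cluster _ _).
  + by apply: inl_boundary => //; apply: leq_ltn_trans (leq_subr _ _) (dense_rank_cluster _ _).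
  + exact: hlt.
  + apply: le_trans (dist_tail_le k j Jb (dense_rank_cluster _ _)) _.
    by rewrite wE mulrDl mul1r addrC lerD ?(ltW hlt) // ler_peMr ?heavy_ge1 // ltW.
(* Blocked by a light edge of the previous cluster; the bound of [dist_center_le] is exactly the
   reach of the first heavy edge of cluster [k]. *)
- apply/orP; right; apply: (@earlier_blocked_at _ _ _ (inr (l, Some ord0))) => //.
  have r0 : (dense_rank (inr (l, Some ord0)) < dense_rank (inr (l, None)))%N.
    by rewrite /= ltn_add2l.
  apply/and4P; split.
  + by apply: inl_boundary (ltnW vlt) => //; apply: leq_ltn_trans rb (dense_rank_cluster _ _).
  + by rewrite /boundary !mo r0 ltnn /= eqxx.
  + by rewrite wE; apply: lt_le_trans (heavy_ge1 _); exact: light_lt1.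
  + apply: le_trans (dist_center_le Jb r0) _.
    by rewrite wE lk i0 addn0.
(* First heavy edge of all: blocked by the last spine edge, from [1] to [0], unless its tail is
   [0]. *)
- have [->|b0] := eqVneq b ord0; first by rewrite eqxx.
  have bp : (0 < b)%N by rewrite lt0n; apply: contra b0 => /eqP b0; apply/eqP/val_inj.
  have Qp : (0 < Q')%N by apply: leq_trans bp _; rewrite -ltnS ltn_ord.
  have one : (inord 1 : 'I_Q'.+1) = 1%N :> nat by rewrite inordK.
  apply/orP; right; apply: (@earlier_blocked_at _ _ _ (inl (inord 1))) => //.
  apply/and4P; split.
  + by apply: inl_boundary (ltnW vlt) => //=; rewrite subn0 ltn_subrL bp.
  + by rewrite /boundary !mo /= one eqxx ?orbT subn0 ltnn subn1 ltn_predL Qp.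
  + by rewrite wE /= one eqxx ?orbT; apply: lt_le_trans lam1 (heavy_ge1 _).
  + apply: (@le_trans _ _ (walk_length dense (inl b) [:: inl ord0])).
      apply: dist_le => //=.
      by rewrite andbT b0 Jb dvdn0 !orbT.
    rewrite /= addr0; apply: le_trans (dense_wt_inl_le b ord0) _.
    have h1 := heavy_ge1 (k * D + i).
    by rewrite (le_trans _ (ler_peMr _ h1)) ?lerDr // addr_ge0 // ltW.
Qed.

Lemma dense_step (v x : vertex) :
  (dense_rank x < #|{: vertex}|)%N -> dense_rank x = (dense_rank v).+1 ->
  exists y, qualifies dense d (take (dense_rank x) o) v y x /\
    (if x is inr (_, Some _) then 1 else 0) <= wt dense y x.
Proof.
case: x => [u|[k [i|]]] _ rv.
- have [u' vE uu] : exists2 u' : 'I_Q'.+1, v = inl u' & u' = u.+1 :> nat.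
    case: v rv => [u'|[l c]] rv.
      by exists u' => //; move: rv => /=; have := ltn_ord u; have := ltn_ord u'; lia.
    by have := dense_rank_cluster l c; move: rv => /=; lia.
  exists (inl u'); rewrite vE; split; last by rewrite /= uu eqxx orbT ltW.
  apply/and3P; split; last by rewrite eqxx.
    by rewrite /boundary !mo ltnn /= uu eqxx orbT /=; have := ltn_ord u'; lia.
  apply/existsP => -[a /existsP[z /and4P[_ bz ltw _]]].
  move: ltw; rewrite /= uu eqxx orbT ltNge => /negP[].
  have h1 t : lam <= heavy t by apply: le_trans (ltW lam1) (heavy_ge1 t).
  case/and3P: bz; rewrite mo; case: a => [a|[l c]]; last first.
    by move=> _ /(ltn_trans (dense_rank_cluster _ _)); rewrite /= ltnNge leq_subr.
  by case: z => [z|[l [c|]]] //= _ _ _; case: ifP.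
- have bE := tail_inord k (ltn_ord i).
  exists (inl (inord (S (k * D + i) * J))); split; last exact: heavy_ge1.
  apply/and3P; split; last exact: heavy_reachable.
    by apply: inl_boundary => //; apply: leq_ltn_trans (leq_subr _ _) (dense_rank_cluster _ _).
  exact: heavy_not_blocked.
- have vE : v = inr (k, Some ord_max) by apply: dense_rank_inj; move: rv => /=; lia.
  rewrite vE; exists (inr (k, Some ord_max)); split; last by rewrite ltW // light_gt0.
  apply/and3P; split; last by rewrite eqxx.
    by rewrite /boundary !mo ltnn /= eqxx ltn_add2l ltnSn.
  apply/existsP => -[a /existsP[z /and4P[_ bz ltw _]]].
  have [|[j _ [aE zE]]] := boundary_dense (leqnn D) bz.
    rewrite leNgt => /negP[]; apply: lt_le_trans (heavy_ge1 _).
    by apply: lt_trans (light_lt1 (ltn_ord k)).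
  by move: ltw; rewrite aE zE /= ltxx.
Qed.

End Run.

(** * Tour length and cost on the high-girth instance *)

Lemma heavy_le2 (k : 'I_K) i : (i < D)%N -> heavy (k * D + i) <= 2.
Proof.
move=> iD; suff : (k * D + i)%:R * eta <= 1 by rewrite /heavy; lra.
apply: le_trans eta_small; apply: (@le_trans _ _ ((K * D * D.+1)%:R * eta)).
  by rewrite ler_pM2r // ler_nat (leq_trans (ltnW (index_lt k iD))) // leq_pmulr.
by rewrite ler_peMl ?lerDl ?(ltW d0) // mulr_ge0 // ltW.
Qed.

Lemma dense_Opt_le : Opt dense <= 2 * (Q'.+1%:R * lam + K%:R * 3).
Proof.
have [_ le] := @Opt_le_tree _ _ dense _ _ _ dense_tree.
apply: le_trans le _; rewrite ler_pM2l ?ltr0n // big_mkcond /=.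
(* Bound on the parent edge of each vertex; a cluster sums to at most 1 + 2 = 3. *)
pose F (x : vertex) : R := match x with
  | inl _ => lam
  | inr (k, c) => light k + if c == Some ord0 then 2 else 0
  end.
apply: (@le_trans _ _ (\sum_x F x)).
  apply: ler_sum => -[u|[k [i|]]] _.
  - case: ifP => [u0|]; last by rewrite ltW.
    have [+ _] := dense_tree u0; rewrite /=.
    have u1 : (0 < u)%N.
      by move: u0; rewrite lt0n; apply: contraNN => /eqP u0; apply/eqP; congr inl; exact: val_inj.
    have uQ : (u.-1 < Q'.+1)%N := leq_ltn_trans (leq_pred _) (ltn_ord u).
    by rewrite inordK // prednK // eqxx.
  - rewrite /= -[Some i == _]/(i == ord0) -(inj_eq val_inj) /=.
    case: eqP => [i0|_]; last by rewrite addr0.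
    by rewrite ler_wpDl ?(ltW (light_gt0 _)) ?heavy_le2.
  - by rewrite /= addr0.
rewrite sum_sum_prod /= sumr_const card_ord -(mulr_natl lam) lerD2l.
apply: (@le_trans _ _ (\sum_(k < K) 3)); last by rewrite sumr_const card_ord mulr_natl.
apply: ler_sum => k _; rewrite big_split /= sumr_const card_option card_ord -big_mkcond /=.
rewrite big_pred1_eq -mulr_natr; have := light_le (ltn_ord k); lra.
Qed.

Lemma dense_Opt_gt0 : (0 < K)%N -> 0 < Opt dense.
Proof.
move=> K0; apply: Opt_gt0.
- by rewrite dense_card mulnS; lia.
- exact: (@Opt_le_tree _ _ dense _ _ _ dense_tree).1.
- by move=> x y; exact: dense_wt_gt0.
Qed.

Lemma dense_cost : (0 < K)%N ->
  exists c, Blocking_cost dense d (inl ord_max) c /\ (K * D)%:R <= c.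
Proof.
move=> K0; have [en [pen sen men nen ren]] := rank_order dense_rank_inj dense_rank_lt.
pose W (x : vertex) : R := if x is inr (_, Some _) then 1 else 0.
have kK : (K.-1 < K)%N by rewrite prednK.
have rT : (dense_rank (inr (Ordinal kK, None))).+1 = size en.
  by rewrite sen dense_card /= -[in RHS](prednK K0) mulSn; lia.
have r0 : dense_rank (inl ord_max) = 0%N by rewrite /= subnn.
have [] := @run_by_rank _ _ dense d en dense_rank W (size en) (inl ord_max)
  (inr (Ordinal kK, None)) 0 (leqnn _) (nen _) (ren _) r0 rT.
- by move=> v x; rewrite sen => xn rv; exact: dense_step.
- have [s [c [r c0 _]]] := run_completes dense d (take (size en) en) (inr (Ordinal kK, None)).
  by exists s, c.
move=> c [bc le]; exists c; split => //; apply: le_trans le; rewrite addr0.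
have en0 : (0 < size en)%N by rewrite -rT.
(* The start vertex, at index [0], has weight [0]. *)
have -> : \sum_(1 <= j < size en) W (nth (inl ord_max) en j) = \sum_x W x.
  have -> : \sum_x W x = \sum_(x <- en) W x by rewrite (perm_big _ pen) /= big_enum.
  rewrite (big_nth (inl ord_max)) [RHS]big_ltn //.
  by have := nen (inl ord_max) (inl ord_max); rewrite r0 => ->; rewrite add0r.
rewrite sum_sum_prod big1 // add0r.
rewrite (eq_bigr (fun _ => D%:R)) => [|k _]; first by rewrite sumr_const card_ord -mulrnA mulnC.
rewrite (eq_bigr (fun c => if predC1 None c then 1 else 0)) => [|[a|] _] //.
by rewrite -big_mkcond sumr_const cardC1 card_option card_ord.
Qed.

Lemma dense_competitive : (0 < K)%N ->
  (((K * D)%:R / (2 * (Q'.+1%:R * lam + K%:R * 3)))%:E <=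
    competitive_ratio d (Q'.+1 + K * D.+1))%E.
Proof.
move=> K0; have [c [bc cle]] := dense_cost K0.
have O0 := dense_Opt_gt0 K0.
apply: (@le_trans _ _ (c / Opt dense)%:E); last first.
  apply: ereal_sup_ubound; exists vertex, dense, (inl ord_max), c.
  by split => //; exact: dense_card.
rewrite lee_fin; apply: ler_pM => //; first by rewrite invr_ge0 (le_trans (ltW O0)) // dense_Opt_le.
by rewrite lef_pV2 ?posrE ?dense_Opt_le // (lt_le_trans O0) // dense_Opt_le.
Qed.

End DenseGraph.

(** * Choice of the parameters *)

(** About half of the vertices form clusters, the rest the spine. With [J = A * D.+1] spine edges
    are so light that the spine costs at most [4 K]; hence [Opt] is at most [14 K], against a cost
    of at least [K * D]. *)
Lemma dense_ratio (R : realType) (d : R) (n D' A : nat) :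
  0 < d -> d <= A%:R -> (0 < A)%N ->
  (4 * (1 + 2 * (A * D'.+2) * D'.+1) ^ A.+1 < n)%N ->
  ((D'.+1%:R / 14)%:E <= competitive_ratio d n)%E.
Proof.
have arith (q m b e : nat) : (m < (e + b) * 2)%N -> (q + b = m)%N -> (e <= b)%N -> (q <= 4 * b)%N.
  by lia.
set D := D'.+1; set J := (A * D.+1)%N => d0 dA A0 large.
have J0 : (0 < J)%N by rewrite muln_gt0 A0.
have A0R : 0 < A%:R :> R by rewrite ltr0n.
have J0R : 0 < J%:R :> R by rewrite ltr0n.
have [K [K0 Kn nK]] : exists K, [/\ (0 < K)%N, (K * D.+1 * 2 <= n)%N & (n < K.+1 * D.+1 * 2)%N].
  exists (n %/ (D.+1 * 2))%N; rewrite -!mulnA leq_divM ltn_ceil // divn_gt0 //; split => //.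
  apply: leq_trans (ltnW large); apply: (@leq_trans (4 * (1 + 2 * J * D))).
    have : (D.+1 <= J * D)%N by rewrite mulnAC leq_pmull // muln_gt0 A0.
    by rewrite -mulnA; lia.
  by rewrite leq_mul2l -{1}[(1 + _)%N]expn1 leq_pexp2l.
pose Q' := (n - K * D.+1).-1.
have nE : (Q'.+1 + K * D.+1 = n)%N.
  rewrite /Q' prednK ?subnK //; first by move: Kn; lia.
  by rewrite subn_gt0; move: Kn; nia.
have Q2 : (n <= 2 * Q'.+1)%N by move: Kn nE; clearbody Q'; lia.
pose lam : R := d / J%:R.
have lamD : lam * D.+1%:R <= 1.
  rewrite /lam /J natrM invfM mulrA divfK // ?pnatr_eq0 //.
  by rewrite ler_pdivrMr ?mul1r.
have lam0 : 0 < lam by rewrite divr_gt0.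
have D2 : 2 <= D.+1%:R :> R by rewrite ler_nat.
pose eta : R := ((1 + d) * (K * D * D.+1)%:R)^-1.
have KD0 : 0 < (K * D * D.+1)%:R :> R by rewrite ltr0n !muln_gt0 K0.
have eta0 : 0 < eta by rewrite invr_gt0 mulr_gt0 // addr_gt0.
(* With [2 * J] uses of each tail the capacity is at least [2 * Q'.+1], hence at least [n]; the
   picks need at most half of [n], and the balls less than a quarter. *)
have [| |S Slev] := @sparse_picks (Q' %/ J).+1 D A (2 * J) (K * D) isT.
- by rewrite muln_gt0.
- have : (Q'.+1 <= J * (Q' %/ J).+1)%N by rewrite mulnC ltn_ceil.
  move: large; rewrite expnS; set W := (_ ^ A)%N; rewrite mulnDl mul1n [(2 * J * (D * W))%N]mulnA.
  have : (K * D * 2 <= K * D.+1 * 2)%N by rewrite leq_mul2r leq_mul2l leqnSn !orbT.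
  set M := (Q' %/ J).+1; rewrite -[(2 * J * M)%N]mulnA; move: Kn Q2.
  move: W (2 * J * D * W)%N (J * M)%N (K * D)%N (K * D.+1)%N => Y X Z a b.
  by clearbody Q'; lia.
have SQ t : (t < K * D)%N -> (S t * J <= Q')%N.
  by move=> /Slev[]; rewrite ltnS leq_divRL.
have lev t : (t < K * D)%N -> _ := fun tK => (Slev t tK).2.
have := @dense_competitive R d lam eta Q' J K D' A S d0 lam0 _ _ _ J0 eta0 _ SQ _ lev K0.
rewrite -/D nE => /(_ _ _ _ _ _) le; apply: le_trans (le _ _ _ _ _).
- rewrite lee_fin ler_pdivlMr; last first.
    by rewrite mulr_gt0 ?ltr0n // addr_gt0 // mulr_gt0 // ltr0n.
  have : Q'.+1%:R * lam <= 4 * K%:R.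
    have : (Q'.+1 <= 4 * K * D.+1)%N.
      rewrite -mulnA; apply: arith nK nE (leq_pmull D.+1 K0).
    rewrite -(ler_nat R) natrM => /(ler_wpM2r (ltW lam0)) h; apply: le_trans h _.
    rewrite -mulrA [D.+1%:R * _]mulrC natrM ler_piMr // mulr_ge0.
  rewrite natrM; have := ler0n R D; nra.
- nra.
- apply: (@le_trans _ _ (d / 1)); last by rewrite divr1.
  by rewrite ler_pM2l // lef_pV2 ?posrE // ler1n.
- by rewrite /lam divfK // gt_eqF.
- by rewrite mulrA mulfV // gt_eqF // mulr_gt0 // addr_gt0.
- by apply: le_trans dA _; rewrite -natrM ler_nat (leq_trans (leqnSn A)) // leq_pmull.
Qed.


Lemma truncn_ge_half (R : realType) (x : R) : 1 <= x ->
  [/\ (0 < Num.truncn x)%N, (Num.truncn x)%:R <= x & x / 2 <= (Num.truncn x)%:R].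
Proof.
move=> x1; have x0 : 0 <= x by apply: le_trans x1.
have /andP[le lt] := truncn_itv x0.
have t0 : (0 < Num.truncn x)%N by rewrite truncn_gt0.
split => //; rewrite -natr1 in lt.
have : 1 <= (Num.truncn x)%:R :> R by rewrite ler1n.
lra.
Qed.

(** A quadratic lower bound is all that the later comparisons with logarithms require. *)
Lemma expR_half_sqr (R : realType) (x : R) : 0 <= x -> (1 + x / 2) ^+ 2 <= expR x.
Proof.
move=> x0; have -> : expR x = expR (x / 2) ^+ 2.
  by rewrite -expRM_natl; congr expR; field.
by rewrite ler_pXn2r // ?nnegrE ?expR_ge0 ?expR_ge1Dx // addr_ge0 // divr_ge0.
Qed.

Lemma broom_regime (R : realType) (d x : R) (n : nat) :
  1 <= x -> x <= d -> x <= ln n%:R -> 12 <= ln n%:R :> R ->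
  ((x / 16)%:E <= competitive_ratio d n)%E.
Proof.
move=> x1 xd xn n12; have [m0 mx xm] := truncn_ge_half x1.
set m := Num.truncn x in m0 mx xm *.
have n0 : 0 < n%:R :> R.
  by rewrite ltr0n lt0n; apply: contraTneq n12 => ->; rewrite ln0 // -ltNge ltr0n.
have mn : (3 * m + 1 < n)%N.
  rewrite -(ltr_nat R) natrD natrM -[ltRHS](lnK n0).
  have := @expR_half_sqr R (ln n%:R); rewrite expr2; nra.
apply: (@le_trans _ _ (m%:R / 8)%:E); first by rewrite lee_fin; lra.
apply: broom_ratio => //; lra.
Qed.

Lemma cubic_le_quartic (D : nat) : (9 <= D)%N -> (1 + 2 * (D * D.+1) * D <= D ^ 4)%N.
Proof.
move=> D9; pose x := (D * D)%N; pose c := (D * x)%N.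
have -> : (D ^ 4 = D * c)%N by rewrite /c /x !expnS expn0 muln1.
have -> : (2 * (D * D.+1) * D = 2 * c + 2 * x)%N by rewrite /c /x; ring.
have x0 : (0 < x)%N by rewrite muln_gt0; case: D D9 {x c}.
have xc : (x <= c)%N by rewrite leq_pmull //; case: D D9 {x c x0}.
have : (9 * c <= D * c)%N by rewrite leq_mul2r D9 orbT.
move: x0 xc; clearbody c x; move: (D * c)%N => y; lia.
Qed.

(** With [D] the integer part of [l] and [A] about [d], the size required by [dense_ratio] is at
    most [l ^+ (4 * A + 5)], which has to stay below [n]. *)
Lemma dense_regime (R : realType) (d : R) (n : nat) (l := ln n%:R : R) :
  0 < d -> 1 <= ln l -> 18 * ln l < l -> d * ln l <= l / 8 ->
  ((l / 28)%:E <= competitive_ratio d n)%E.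
Proof.
have arith a : (4 * a + 5 = 1 + 4 * a.+1)%N by lia.
move=> d0 l1 l18 dl; have l2 : 18 < l by lra.
have ll : 1 <= l by lra.
have n0 : 0 < n%:R :> R.
  by rewrite ltr0n lt0n; apply: contraTneq l2 => n0; rewrite /l n0 ln0 // -leNgt ler0n.
have [D0 Dl lD] := truncn_ge_half ll; set D := Num.truncn l in D0 Dl lD.
pose A := (Num.truncn d).+1.
have /andP[Ad dA] := truncn_itv (ltW d0); rewrite -/A in dA.
have dl8 : d <= l / 8 by nra.
have AD : (A <= D)%N.
  rewrite -(ltr_nat R); have := truncn_itv (le_trans ler01 ll); rewrite -/D => /andP[_].
  rewrite /A -!natr1; lra.
apply: (@le_trans _ _ (D%:R / 14)%:E); first by rewrite lee_fin; lra.
have DE : D.-1.+1 = D by rewrite prednK.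
rewrite -DE; apply: (dense_ratio d0 (ltW dA)) => //; rewrite DE.
have D9 : (9 <= D)%N.
  by rewrite truncn_ge_nat ?(le_trans ler01) //; lra.
have P : (4 * (1 + 2 * (A * D.+1) * D) ^ A.+1 <= D ^ (4 * A + 5))%N.
  have b : (1 + 2 * (A * D.+1) * D <= D ^ 4)%N.
    apply: (@leq_trans (1 + 2 * (D * D.+1) * D)); first by rewrite leq_add2l leq_mul2r leq_mul2l leq_mul2r AD !orbT.
    exact: cubic_le_quartic.
  rewrite arith expnD expn1 expnM leq_mul ?leq_exp2r //.
  exact: leq_trans D9.
apply: leq_ltn_trans P _; rewrite -(ltr_nat R) natrX -[ltRHS](lnK n0).
apply: (@le_lt_trans _ _ (l ^+ (4 * A + 5))).
  by rewrite lerXn2r // ?nnegrE // (le_trans ler01).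
rewrite -[X in X ^+ _](@lnK R l) ?posrE ?(lt_le_trans ltr01) // -expRM_natl ltr_expR -/l.
(* The exponent times [ln l] is at most [4 * d * ln l + 9 * ln l], where the hypotheses make the
   first term at most [l / 2] and the second less than that. *)
have : (4 * A + 5)%:R <= 4 * d + 9 :> R.
  rewrite natrD natrM /A -natr1; lra.
nra.
Qed.

(** * Asymptotics *)

Lemma near_ln_ln_ge (R : realType) (B : R) :
  \forall n \near \oo, B <= ln (ln (n%:R : R)).
Proof.
near=> n.
have nB : expR (expR B) <= n%:R by near: n; exact: nbhs_infty_ger.
have n0 : 0 < n%:R :> R by apply: lt_le_trans nB; exact: expR_gt0.
have lB : expR B <= ln n%:R by rewrite -ler_expR lnK.
by rewrite -ler_expR lnK // posrE; apply: lt_le_trans lB; exact: expR_gt0.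
Unshelve. all: by end_near. Qed.

(** For [y = ln l] one has [l >= 1 + y + y ^+ 2 / 4], and the last term is at least [18 * y] once
    [y >= 72]. *)
Lemma ln_ln_large (R : realType) (l : R) : 72 <= ln l -> 18 * ln l < l.
Proof.
move=> l72; have l0 : 0 < l.
  by rewrite ltNge; apply/negP => l0; rewrite ln0 // in l72; move: l72; rewrite leNgt ltr0n.
have := @expR_half_sqr R (ln l); rewrite (lnK l0) expr2; nra.
Qed.

Theorem theorem3 (R : realType) (delta : nat -> R)
    (delta_gt0 : forall n : nat, 0 < delta n) :
  let ratio := fun n : nat => competitive_ratio (delta n) n in
  eOmega ratio (log_over_loglog R) /\
  (delta =o_\oo log_over_loglog R -> eOmega ratio (log_nat R)) /\
  (delta \is 'Omega_\oo (log_nat R) -> eOmega ratio (log_nat R)).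
Proof.
move=> ratio; split; [|split].
- exists (1 / 128); first by lra.
  near=> n; rewrite /ratio /log_over_loglog /log_nat.
  have L72 : 72 <= ln (ln n%:R) :> R by near: n; exact: near_ln_ln_ge.
  have l18 := ln_ln_large L72.
  set l := ln n%:R in L72 l18 *; set y := ln l in L72 l18 *.
  have y0 : 0 < y by lra.
  have y1 : 1 <= y by lra.
  have z18 : 18 <= l / y by rewrite ler_pdivlMr // ltW.
  have zl : l / y <= l by rewrite ler_pdivrMr // ler_peMr //; lra.
  (* Small [delta] uses the clusters. Otherwise the broom applies with [x = l / y / 8], and 8 times
     16 gives the constant 128. *)
  have [dl|ld] := leP (delta n * y) (l / 8).
    apply: le_trans (dense_regime (delta_gt0 n) y1 l18 dl).
    by rewrite lee_fin -/l; lra.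
  have x1 : 1 <= l / y / 8 by lra.
  apply: le_trans (broom_regime x1 _ _ _).
  + by rewrite lee_fin -/l; lra.
  + by rewrite mulrAC ler_pdivrMr // ltW.
  + by rewrite -/l; lra.
  + by rewrite -/l; lra.
- move=> /eqoP small; exists (1 / 28); first by lra.
  near=> n; rewrite /ratio /log_nat.
  have L72 : 72 <= ln (ln n%:R) :> R by near: n; exact: near_ln_ln_ge.
  have l18 := ln_ln_large L72.
  have : `|delta n| <= 1 / 8 * `|log_over_loglog R n|.
    near: n; apply: small; lra.
  rewrite (gtr0_norm (delta_gt0 n)) /log_over_loglog /log_nat.
  set l := ln n%:R in L72 l18 *; set y := ln l in L72 l18 * => dl.
  have y0 : 0 < y by lra.
  have y1 : 1 <= y by lra.
  have lyE : l / y * y = l by rewrite divfK // gt_eqF.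
  rewrite mulrC mul1r; apply: (dense_regime (delta_gt0 n) y1 l18); rewrite -/l -/y.
  rewrite ger0_norm in dl; last by rewrite divr_ge0; lra.
  nra.
- rewrite qualifE => /asboolP[k k0 large].
  (* The cap at [1] ensures that [c * l <= ln n], as [broom_regime] demands of its [x]. *)
  pose c := Num.min k 1.
  have c0 : 0 < c by rewrite lt_min k0 ltr01.
  exists (c / 16); first by rewrite divr_gt0.
  near=> n; rewrite /ratio /log_nat.
  (* The bound by [c^-1] yields [1 <= c * l]. *)
  have lc : Num.max 72 c^-1 <= ln (ln n%:R) :> R by near: n; exact: near_ln_ln_ge.
  rewrite ge_max in lc; have /andP[L72 Lc] := lc.
  have l18 := ln_ln_large L72.
  have : k * `|log_nat R n| <= `|delta n| by near: n; exact: large.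
  rewrite (gtr0_norm (delta_gt0 n)) /log_nat.
  set l := ln n%:R in L72 Lc l18 *; set y := ln l in L72 Lc l18 * => dl.
  have l0 : 0 < l by lra.
  rewrite (gtr0_norm l0) in dl.
  have ck : c <= k by rewrite ge_min lexx.
  have c1 : c <= 1 by rewrite ge_min lexx orbT.
  have cV : c * c^-1 = 1 by rewrite mulfV // gt_eqF.
  rewrite mulrAC; apply: broom_regime; rewrite -/l; [|nra|nra|lra].
  rewrite -cV ler_pM2l //; lra.
Unshelve. all: by end_near. Qed.
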